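(* Let $n \in \mathbb{N}$. There exists a semigroup identity satisfied by $\mathbb{P}_n$ but not satisfied by $\mathbb{P}_{n+1}$.
   Context: $\mathbb{N} = \{1,2,\dots\}$. For an alphabet $\Sigma$, $\Sigma^+$ is the semigroup of all non-empty words over $\Sigma$ under concatenation. A semigroup identity ''$u=v$'' is a pair of distinct non-empty words over an alphabet $\Sigma$; a semigroup $S$ satisfies $u=v$ if every semigroup morphism $\Sigma^+ \to S$ maps $u$ and $v$ to the same element of $S$. The plactic monoid of rank $n$, $\mathbb{P}_n$, is the monoid generated by $\{1,\dots,n\}$ subject to the Knuth relations: $bca = bac$ for $1 \le a < b \le c \le n$, and $cab = acb$ for $1 \le a \le b < c \le n$. *)

(* Defs.v *)
From HB Require Import structures.
From mathcomp Require Import all_boot.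
From mathcomp Require Import boolp.

Set Implicit Arguments.
Unset Strict Implicit.
Unset Printing Implicit Defensive.

Local Open Scope quotient_scope.

Record free_semigroup (T : Type) := FreeSemigroup {
  letters :> seq T;
  _ : ~~ nilp letters
}.

HB.instance Definition _ (T : Type) := [isSub for @letters T].
HB.instance Definition _ (T : choiceType) :=
  [Choice of free_semigroup T by <:].

Section FreeSemigroup.
Variable T : choiceType.
Implicit Types u v w : free_semigroup T.

Fact fs_mul_subproof u v : ~~ nilp (u ++ v).
Proof. by case: u => -[]. Qed.

Definition fs_mul u v := FreeSemigroup (fs_mul_subproof u v).

Fact fs_mulA : associative fs_mul.
Proof. by move=> u v w; apply/val_inj; rewrite /= catA. Qed.

HB.instance Definition _ := isSemigroup.Build (free_semigroup T) fs_mulA.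

End FreeSemigroup.

Record semigroup_identity := SemigroupIdentity {
  alphabet : finType;
  lhs : free_semigroup alphabet;
  rhs : free_semigroup alphabet;
  _ : lhs <> rhs
}.

Definition satisfies (S : semigroupType) (e : semigroup_identity) : Prop :=
  forall f : {multiplicative free_semigroup (alphabet e) -> S},
    f (lhs e) = f (rhs e).

Section Presentation.
Variables (T : choiceType) (R : seq T -> seq T -> Prop).

Inductive congruence : seq T -> seq T -> Prop :=
| congruence_rel u v of R u v : congruence u v
| congruence_refl u : congruence u u
| congruence_sym u v of congruence u v : congruence v u
| congruence_trans v u w of congruence u v & congruence v w : congruence u w
| congruence_cat u u' v v' of congruence u u' & congruence v v' :
    congruence (u ++ v) (u' ++ v').

(* Quotient types need a boolean relation, whence the use of [asbool]. *)
Definition congruenceb : rel (seq T) := fun u v => `[< congruence u v >].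

Fact congruenceb_refl : reflexive congruenceb.
Proof. by move=> u; apply/asboolP/congruence_refl. Qed.

Fact congruenceb_sym : symmetric congruenceb.
Proof. by move=> u v; apply/asboolP/asboolP; apply: congruence_sym. Qed.

Fact congruenceb_trans : transitive congruenceb.
Proof.
move=> v u w /asboolP uv /asboolP vw.
exact/asboolP/(congruence_trans uv vw).
Qed.

Canonical congruence_equiv :=
  EquivRel congruenceb congruenceb_refl congruenceb_sym congruenceb_trans.

Definition presented_monoid := {eq_quot congruence_equiv}.

HB.instance Definition _ := Choice.on presented_monoid.
HB.instance Definition _ := EqQuotient.on presented_monoid.

Lemma pi_eqP (u v : seq T) :
  congruence u v <-> \pi_presented_monoid u = \pi_presented_monoid v.
Proof.
split=> [uv|/eqmodP /asboolP //].
exact/eqmodP/asboolP.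
Qed.

Definition pm_one : presented_monoid := \pi_presented_monoid [::].
Definition pm_mul (x y : presented_monoid) : presented_monoid :=
  \pi_presented_monoid (repr x ++ repr y).

Lemma pi_cat (u v : seq T) :
  \pi_presented_monoid (u ++ v) = pm_mul (\pi u) (\pi v).
Proof.
by apply/pi_eqP/congruence_cat; apply/pi_eqP; rewrite reprK.
Qed.

Fact pm_mulA : associative pm_mul.
Proof.
move=> x y z; rewrite -[x]reprK -[y]reprK -[z]reprK.
by rewrite -!pi_cat catA.
Qed.

Fact pm_1mul : left_id pm_one pm_mul.
Proof. by move=> x; rewrite -[x]reprK -pi_cat. Qed.

Fact pm_mul1 : right_id pm_one pm_mul.
Proof. by move=> x; rewrite -[x]reprK -pi_cat cats0. Qed.

HB.instance Definition _ :=
  isMonoid.Build presented_monoid pm_mulA pm_1mul pm_mul1.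

End Presentation.

(* The generators 1, ..., n are represented by the ordinals 0, ..., n.-1. *)
Inductive knuth (n : nat) : seq 'I_n -> seq 'I_n -> Prop :=
| knuth_bca (a b c : 'I_n) of a < b & b <= c :
    knuth [:: b; c; a] [:: b; a; c]
| knuth_cab (a b c : 'I_n) of a <= b & b < c :
    knuth [:: c; a; b] [:: a; c; b].

Definition plactic (n : nat) := presented_monoid (@knuth n).

HB.instance Definition _ (n : nat) := Monoid.on (plactic n).

(* Main.v *)
Require Import Defs.
From HB Require Import structures.
From mathcomp Require Import all_boot fingroup perm zify.
From mathcomp Require Import boolp.

Set Implicit Arguments.
Unset Strict Implicit.
Unset Printing Implicit Defensive.

(** Words are measured by a refinement of Greene's numbers: for two vectors s
and t indexed by k colours, [pack w s t] is the largest number of letters of w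
that can be covered by k disjoint nondecreasing subsequences, the one of colour
c using only letters between [s c] and [t c].  With constant bounds this number
is a plactic invariant ([pack_congr]), and taken over all k <= n and over all
restrictions to an initial segment of the alphabet these numbers determine the
plactic class ([pack_complete]), because they give the shape of every restriction
of the tableau of the word.

The identities form a ladder.  Rung 0 is the pair (ab, ba).  If rung h is the
pair (a, b), rung h+1 is obtained by writing a, respectively b, at the place of
the dot in
<<
        a b z x . z^M x^M a^(M-1) b a^M
>>
where z and x are two new letters.  Three facts give the theorem.

High rungs hold in rank n ([pack_ladder]).  Follow the vector of last letters
used by the k colours: it moves up at most k n times, counting unit steps.  By
induction, rung h is not detected by colourings moving at most h steps.  At rung
h+1, either only part of the motion happens inside the centre, and the induction
hypothesis applies to the centre, or the whole motion does.  In the latter case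
the colouring is constant before and after the centre, so moving the motion into
another copy of the central word changes the number of covered letters by a
linear function of the displacement.  The frame contains copies of a (and of b)
on either side of the centre whose displacements are opposite up to a positive
factor M; hence one of them is at least as good as the centre, and the centre is
irrelevant.

A rung that fails in rank n is followed by a rung that fails in rank n+1
([detect]).  Let the letters be 0, ..., n, the failing substitution using only
1, ..., n.  For a suitable k, the letters z and x can be replaced by words over
0, ..., n which act as barriers.  In an optimal colouring, up to the order of the
colours, the state is below (0, ..., k-1) when it meets the first x.  It can then
start the centre from (1, ..., k), which costs nothing for words on positive
letters, and it ends the centre below (n-k+1, ..., n), which again costs nothing
([pack_centre]).  So the optimum is a constant plus the optimum of the centre.
The extra letter 0 is what leaves room for a step of every colour across x.

Finally let h be the first rung that holds in rank n.  If h > 0 then rung h-1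
fails in rank n, so rung h fails in rank n+1; if h = 0 then ab = ba already fails
in rank 2. *)

(** * Packing a word by bounded nondecreasing subsequences *)

Section Pack.
Variable k : nat.
Implicit Types (s t r : {ffun 'I_k -> nat}) (w u v : seq nat) (c d : 'I_k).

Definition upd s c e : {ffun 'I_k -> nat} := [ffun d => if d == c then e else s d].
Definition cst (N : nat) : {ffun 'I_k -> nat} := [ffun => N].
Definition le_st s t := forall c, s c <= t c.

(** The first vector plays the role of a state: it records the last letter used
by each colour, so that reading a word never lowers it.  A colour c with
[t c < s c] is simply unable to take any letter. *)
Fixpoint pack w s t : nat :=
  if w is e :: w' then
    maxn (pack w' s t) (\max_(c | s c <= e <= t c) (pack w' (upd s c e) t).+1)
  else 0.

Lemma le_st_trans r s t : le_st s r -> le_st r t -> le_st s t.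
Proof. by move=> h1 h2 c; apply: leq_trans (h1 c) (h2 c). Qed.

Lemma le_upd s c e : s c <= e -> le_st s (upd s c e).
Proof. by move=> h d; rewrite ffunE; case: eqP => [->|]. Qed.

Lemma upd_le s t c e : le_st s t -> e <= t c -> le_st (upd s c e) t.
Proof. by move=> h1 h2 d; rewrite ffunE; case: eqP => [->|]. Qed.

Lemma upd_mono s t c e e' : le_st s t -> e <= e' -> le_st (upd s c e) (upd t c e').
Proof. by move=> h1 h2 d; rewrite !ffunE; case: eqP. Qed.

Lemma upd_id s c : upd s c (s c) = s.
Proof. by apply/ffunP => d; rewrite ffunE; case: eqP => [->|]. Qed.

Lemma upd_upd s c e e' : upd (upd s c e) c e' = upd s c e'.
Proof. by apply/ffunP => d; rewrite !ffunE; case: eqP. Qed.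

Lemma pack_skip e w s t : pack w s t <= pack (e :: w) s t.
Proof. exact: leq_maxl. Qed.

Lemma pack_take e w s t c : s c <= e <= t c ->
  (pack w (upd s c e) t).+1 <= pack (e :: w) s t.
Proof.
move=> h /=; apply: leq_trans (leq_maxr _ _).
by apply: (leq_bigmax_cond (F := fun c => (pack w (upd s c e) t).+1)).
Qed.

Lemma pack_consP e w s t : pack (e :: w) s t = pack w s t \/
  exists2 c, s c <= e <= t c & pack (e :: w) s t = (pack w (upd s c e) t).+1.
Proof.
set m := \max_(c | s c <= e <= t c) (pack w (upd s c e) t).+1.
have -> : pack (e :: w) s t = maxn (pack w s t) m by [].
case: (leqP m (pack w s t)) => h; first by left.
right; have : 0 < #|[pred c | s c <= e <= t c]|.
  rewrite lt0n; apply/eqP => h0; move: h; rewrite /m big_pred0 // => c.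
  by have /card0_eq/(_ c) := h0; rewrite !inE.
move/(eq_bigmax_cond (fun c => (pack w (upd s c e) t).+1)) => [c].
rewrite inE => hc hm; exists c => //; rewrite -hm.
Qed.

Lemma pack_mono w s s' t t' : le_st s' s -> le_st t t' -> pack w s t <= pack w s' t'.
Proof.
elim: w s s' => [|e w IH] s s' hs ht //.
have [->|[c /andP[h1 h2] ->]] := pack_consP e w s t.
  exact: leq_trans (IH _ _ hs ht) (pack_skip _ _ _ _).
apply: leq_trans (pack_take (c := c) _ _).
  by rewrite ltnS; apply: IH ht; apply: upd_mono.
by rewrite (leq_trans (hs c)) // (leq_trans h2).
Qed.

Lemma pack_size w s t : pack w s t <= size w.
Proof.
elim: w s => // e w IH s.
have [->|[c _ ->]] := pack_consP e w s t; [exact: leqW|exact: IH].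
Qed.

Lemma pack_permle (p : {perm 'I_k}) w s t :
  pack w s t <= pack w [ffun c => s (p c)] [ffun c => t (p c)].
Proof.
elim: w s => // e w IH s.
have [->|[c hc ->]] := pack_consP e w s t.
  exact: leq_trans (IH _) (pack_skip _ _ _ _).
apply: leq_trans (pack_take (c := (p^-1)%g c) _ _); last by rewrite !ffunE permKV.
rewrite ltnS; apply: leq_trans (IH _) _; apply: pack_mono => // d.
by rewrite !ffunE -(inj_eq (@perm_inj _ p) d) permKV.
Qed.

Lemma pack_perm (p : {perm 'I_k}) w s t :
  pack w [ffun c => s (p c)] [ffun c => t (p c)] = pack w s t.
Proof.
apply/eqP; rewrite eqn_leq pack_permle andbT.
apply: leq_trans (pack_permle p^-1%g _ _ _) _.
by apply: pack_mono => c; rewrite !ffunE permKV.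
Qed.

(** Two independent bounds r and r' at the junction are convenient: the first
word may stop below r while the second one starts only above r'. *)
Lemma pack_cat_ge u v s r r' t : le_st r r' -> le_st r t -> le_st s r' ->
  pack u s r + pack v r' t <= pack (u ++ v) s t.
Proof.
move=> hrr hrt; elim: u s => [|e u IH] s hs; first by rewrite add0n; apply: pack_mono.
have [->|[c /andP[h1 h2] ->]] := pack_consP e u s r.
  exact: leq_trans (IH _ hs) (pack_skip _ _ _ _).
rewrite cat_cons; apply: leq_trans (pack_take (c := c) _ _).
  by rewrite addSn ltnS; apply: IH; apply: upd_le => //; apply: leq_trans h2 (hrr c).
by rewrite h1 (leq_trans h2).
Qed.

Lemma pack_cat_le u v s t : le_st s t -> exists r,
  [/\ le_st s r, le_st r t & pack (u ++ v) s t <= pack u s r + pack v r t].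
Proof.
elim: u s => [|e u IH] s hs; first by exists s; split=> //; apply: leq_addl.
rewrite cat_cons; have [->|[c /andP[h1 h2] ->]] := pack_consP e (u ++ v) s t.
  have [r [h1 h2 h3]] := IH _ hs; exists r; split=> //.
  by apply: leq_trans h3 _; rewrite leq_add2r pack_skip.
have [r [h3 h4 h5]] := IH _ (upd_le hs h2); exists r; split=> //.
  exact: le_st_trans (le_upd h1) h3.
apply: (@leq_trans (pack u (upd s c e) r + pack v r t).+1) => //.
rewrite -addSn leq_add2r; apply: pack_take; rewrite h1 /=.
by have := h3 c; rewrite ffunE eqxx.
Qed.

Lemma pack_prefix u v s t : pack u s t <= pack (u ++ v) s t.
Proof.
elim: u s => // e u IH s; rewrite cat_cons; have [->|[c hc ->]] := pack_consP e u s t.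
  exact: leq_trans (IH _) (pack_skip _ _ _ _).
by apply: leq_trans (pack_take _ hc); rewrite ltnS.
Qed.

(** A colour confined to one letter takes all its occurrences, so the packing
number of a motionless state is linear in the content of the word.  This is what
makes all displacement arguments linear. *)
Lemma pack_diag w s : pack w s s = count [in codom s] w.
Proof.
elim: w => // e w IH; apply/eqP; rewrite eqn_leq; apply/andP; split.
  have [->|[c]] := pack_consP e w s s; first by rewrite IH /= leq_addl.
  rewrite -eqn_leq => /eqP <- ->; rewrite upd_id IH /=.
  by rewrite codom_f.
rewrite /= -/(pack (e :: w) s s).
case: (boolP (e \in codom s)) => [/codomP[c ->]|_]; last first.
  by rewrite -IH; apply: (pack_skip e).
by have := @pack_take (s c) w s s c; rewrite leqnn upd_id IH => /(_ isT).
Qed.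

Lemma pack_delete u e v s t : pack (u ++ e :: v) s t <= (pack (u ++ v) s t).+1.
Proof.
elim: u s => [|f u IH] s.
  rewrite /cat; have [->|[c /andP[h _] ->]] := pack_consP e v s t; first exact: leqnSn.
  by rewrite ltnS; apply: pack_mono => //; apply: le_upd.
rewrite !cat_cons; have [->|[c h ->]] := pack_consP f (u ++ e :: v) s t.
  by apply: leq_trans (IH _) _; rewrite ltnS pack_skip.
by rewrite ltnS; apply: leq_trans (IH _) (pack_take _ h).
Qed.

Lemma pack_drop u e v s t : (forall c, ~~ (s c <= e <= t c)) ->
  pack (u ++ e :: v) s t <= pack (u ++ v) s t.
Proof.
elim: u s => [|f u IH] s hs.
  rewrite /cat; have [-> //|[c h _]] := pack_consP e v s t.
  by rewrite (negbTE (hs c)) in h.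
rewrite !cat_cons; have [->|[c h ->]] := pack_consP f (u ++ e :: v) s t.
  by apply: leq_trans (IH _ hs) _; rewrite pack_skip.
apply: leq_trans (pack_take _ h); rewrite ltnS; apply: IH => d.
apply: contra (hs d) => /andP[h1 ->]; rewrite andbT.
by apply: leq_trans h1; apply: le_upd; case/andP: h.
Qed.

(** Repeating every letter b times multiplies all packing numbers by b, since
splitting a block of equal letters between two colours only raises both of them;
this provides weights that dominate a bounded amount of other letters. *)
Definition blow b w := flatten [seq nseq b e | e <- w].

Lemma pack_nseq b e w s t : pack (nseq b e ++ w) s t <= pack w s t \/
  exists2 c, s c <= e <= t c &
    pack (nseq b e ++ w) s t <= b + pack w (upd s c e) t.
Proof.
elim: b s => [|b IH] s; first by left.
rewrite /=; case: (pack_consP e (nseq b e ++ w) s t) => [|[c hc]] /= ->.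
  case: (IH s) => [h|[c hc h]]; first by left.
  by right; exists c => //; apply: leq_trans h _; rewrite addSn.
right; exists c => //; rewrite addSn ltnS.
case: (IH (upd s c e)) => [h|[c' /andP[h1 h2] h]]; first by rewrite (leq_trans h) ?leq_addl.
by apply: leq_trans h _; rewrite leq_add2l; apply: pack_mono => //; apply: le_upd.
Qed.

Lemma pack_nseq_ge b e w s t c : s c <= e <= t c ->
  b + pack w (upd s c e) t <= pack (nseq b e ++ w) s t.
Proof.
move=> /andP[h1 h2]; elim: b s h1 => [|b IH] s h1 /=.
  by apply: pack_mono => //; apply: le_upd.
apply: leq_trans (pack_take (c := c) _ _); last by rewrite h1.
rewrite addSn ltnS; apply: leq_trans (IH (upd s c e) _); last by rewrite ffunE eqxx.
by rewrite upd_upd.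
Qed.

Lemma pack_blow b w s t : pack (blow b w) s t = b * pack w s t.
Proof.
elim: w s => [|e w IH] s; first by rewrite muln0.
have -> : blow b (e :: w) = nseq b e ++ blow b w by [].
apply/eqP; rewrite eqn_leq; apply/andP; split.
  case: (pack_nseq b e (blow b w) s t) => [h|[c hc h]]; apply: leq_trans h _.
    by rewrite IH leq_mul2l pack_skip orbT.
  by rewrite IH -mulnS leq_mul2l (pack_take _ hc) orbT.
have [->|[c hc ->]] := pack_consP e w s t.
  rewrite -IH; move: (blow b w) => v.
  elim: b {IH} => // b; move/leq_trans; apply; exact: pack_skip.
by rewrite mulnS -IH pack_nseq_ge.
Qed.

End Pack.

(** * Invariance under the Knuth relations *)

(** The Knuth relations are taken over all natural numbers, in order that words
of different ranks can be compared without change of type. *)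
Inductive nat_knuth : seq nat -> seq nat -> Prop :=
| nat_knuth_bca a b c of a < b & b <= c : nat_knuth [:: b; c; a] [:: b; a; c]
| nat_knuth_cab a b c of a <= b & b < c : nat_knuth [:: c; a; b] [:: a; c; b].

Notation nat_congr := (congruence nat_knuth).

Section Inv.
Variables (k N : nat).
Implicit Types (s t r : {ffun 'I_k -> nat}) (w u v : seq nat) (c d : 'I_k).
Let V w s := pack w s (cst k N).

Lemma V_skip e w s : V w s <= V (e :: w) s.
Proof. exact: pack_skip. Qed.

Lemma V_take e w s c : s c <= e -> e <= N -> (V w (upd s c e)).+1 <= V (e :: w) s.
Proof. by move=> h1 h2; apply: pack_take; rewrite h1 ffunE. Qed.

Lemma V_consP e w s : V (e :: w) s = V w s \/
  exists c, [/\ s c <= e, e <= N & V (e :: w) s = (V w (upd s c e)).+1].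
Proof.
have [h|[c hc h]] := pack_consP e w s (cst k N); first by left.
by right; exists c; move: hc h; rewrite ffunE => /andP[? ?] ?; split.
Qed.

Lemma V_anti w s s' : le_st s s' -> V w s' <= V w s.
Proof. by move=> h; apply: pack_mono. Qed.

Lemma updC s c d e f : c != d -> upd (upd s c e) d f = upd (upd s d f) c e.
Proof.
move=> cd; apply/ffunP => x; rewrite !ffunE.
by case: (x =P d) => [->|//]; rewrite eq_sym (negbTE cd).
Qed.

(** The upper bounds being all equal, the colours are interchangeable. *)
Lemma V_tperm w s c d e f : c != d ->
  V w (upd (upd s c e) d f) = V w (upd (upd s c f) d e).
Proof.
move=> cd; rewrite /V -(pack_perm (tperm c d)); congr (pack w _ _); apply/ffunP => x.
  rewrite !ffunE; case: tpermP => [->|->|/eqP xc /eqP xd].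
  - by rewrite eqxx (negbTE cd) eqxx.
  - by rewrite (negbTE cd) !eqxx.
  - by rewrite (negbTE xc) (negbTE xd).
by rewrite !ffunE.
Qed.

(** Exchanging two adjacent letters can only hurt a colour that takes both. *)
Lemma V_swapP x y w s : V (x :: y :: w) s <= V (y :: x :: w) s \/
  exists c, [/\ s c <= x, x <= y, y <= N & V (x :: y :: w) s = (V w (upd s c y)).+2].
Proof.
have [->|[c [cx xN ->]]] := V_consP x (y :: w) s.
  left; have [->|[c [cy yN ->]]] := V_consP y w s.
    exact: leq_trans (V_skip x w s) (V_skip y _ s).
  by apply: leq_trans (V_take _ cy yN); rewrite ltnS V_skip.
have [->|[d [dy yN ->]]] := V_consP y w (upd s c x).
  by left; apply: leq_trans (V_skip y _ s); apply: V_take.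
have [cd|cd] := eqVneq c d.
  by right; exists c; subst d; move: dy; rewrite ffunE eqxx => dy; rewrite upd_upd; split.
left; move: dy; rewrite ffunE eq_sym (negbTE cd) => dy.
apply: leq_trans (V_take _ dy yN); rewrite ltnS updC //.
by apply: V_take => //; rewrite ffunE (negbTE cd).
Qed.

Lemma V_swap_gt x y w s : y < x -> V (x :: y :: w) s <= V (y :: x :: w) s.
Proof. by move=> yx; have [//|[c [_ xy]]] := V_swapP x y w s; lia. Qed.

Lemma V_ctx x u v : (forall s, V u s <= V v s) -> forall s, V (x :: u) s <= V (x :: v) s.
Proof.
move=> h s; have [->|[c [cx xN ->]]] := V_consP x u s.
  exact: leq_trans (h s) (V_skip x v s).
by apply: leq_trans (V_take _ cx xN); rewrite ltnS.
Qed.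

(** When a colour takes a and then c, the letter b is either free, and replaces
a, or it belongs to another colour, and the two colours exchange their tails. *)
Lemma V_bca (a b c : nat) w s : a < b -> b <= c ->
  V [:: b, c, a & w] s = V [:: b, a, c & w] s.
Proof.
move=> ab bc; apply/eqP; rewrite eqn_leq; apply/andP; split.
  by apply: V_ctx => s'; apply: V_swap_gt; lia.
have [->|[d [db bN ->]]] := V_consP b [:: a, c & w] s.
  have [h|[d [da _ cN ->]]] := V_swapP a c w s.
    exact: leq_trans h (V_skip b _ s).
  apply: leq_trans (V_take (c := d) _ _ _); try lia.
  rewrite ltnS; apply: leq_trans (V_take (c := d) _ _ _) => //; last by rewrite ffunE eqxx.
  by rewrite ltnS upd_upd; apply: V_skip.
have [h|[d' [da _ cN ->]]] := V_swapP a c w (upd s d b).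
  by apply: leq_trans (V_take _ db bN); rewrite ltnS.
(* b and c now form the tail of d, and a is followed by the former tail of d. *)
have dd' : d != d' by apply: contraTneq da => <-; rewrite ffunE eqxx; lia.
move: da; rewrite ffunE eq_sym (negbTE dd') => da.
apply: leq_trans (V_take _ db bN); rewrite ltnS.
apply: leq_trans (V_take (c := d) _ _ _) => //; last by rewrite ffunE eqxx.
rewrite ltnS upd_upd; apply: leq_trans (V_take (c := d') (e := a) _ _ _); try lia.
  by rewrite ltnS V_tperm //; apply: V_anti; apply: upd_mono => //; lia.
by rewrite ffunE eq_sym (negbTE dd').
Qed.

Lemma V_cab (a b c : nat) w s : a <= b -> b < c ->
  V [:: c, a, b & w] s = V [:: a, c, b & w] s.
Proof.
move=> ab bc; apply/eqP; rewrite eqn_leq V_swap_gt /=; last lia.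
have [//|[d [da _ cN ->]]] := V_swapP a c (b :: w) s.
have [->|[d' [db bN ->]]] := V_consP b w (upd s d c).
  apply: leq_trans (V_skip c _ s).
  apply: leq_trans (V_take (c := d) _ _ _); try lia.
  rewrite ltnS; apply: leq_trans (V_take (c := d) _ _ _); try lia; last by rewrite ffunE eqxx.
  by rewrite ltnS upd_upd; apply: V_anti; apply: upd_mono => //; lia.
have dd' : d != d' by apply: contraTneq db => <-; rewrite ffunE eqxx; lia.
move: db; rewrite ffunE eq_sym (negbTE dd') => db.
apply: leq_trans (V_take (c := d') _ _ _); try lia.
rewrite ltnS; apply: leq_trans (V_take (c := d) _ _ _); try lia.
  rewrite ltnS; apply: leq_trans (V_take (c := d) _ _ _) => //; last by rewrite ffunE eqxx.
  rewrite ltnS upd_upd (@updC s d d' c b) // (@V_tperm w s d' d b c) //.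
  by rewrite eq_sym.
by rewrite ffunE (negbTE dd').
Qed.

End Inv.

Lemma pack_congr k N u v s : nat_congr u v ->
  pack u s (cst k N) = pack v s (cst k N).
Proof.
move=> uv; suff h : forall w s, pack (u ++ w) s (cst k N) = pack (v ++ w) s (cst k N).
  by move: (h [::] s); rewrite !cats0.
elim: uv => {u v s}.
- by move=> u v [a b c ab bc|a b c ab bc] w s; [exact: V_bca|exact: V_cab].
- by [].
- by move=> u v _ IH w s.
- by move=> v u w _ IH1 _ IH2 x s; rewrite IH1.
move=> u u' v v' _ IH1 _ IH2 w s; rewrite -!catA IH1.
elim: u' s {IH1} => [|e u' IH] s; first exact: IH2.
by rewrite !cat_cons; apply/eqP; rewrite eqn_leq; apply/andP; split;
  apply: V_ctx => s'; rewrite /= IH.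
Qed.

(** * Tableaux and completeness of the packing numbers *)

Section Cells.
Variable k : nat.
Implicit Types (s t q : {ffun 'I_k -> nat}) (cs : seq (nat * nat)).

(** A word given as a list of cells (letter, label) is packed by giving the
cells labelled i to colour i. *)
Lemma pack_ge_rows cs s t :
  pairwise (fun x y => (x.2 == y.2) ==> (x.1 <= y.1)) cs ->
  (forall x (c : 'I_k), x \in cs -> x.2 = c -> s c <= x.1 <= t c) ->
  count (fun x => x.2 < k) cs <= pack (map fst cs) s t.
Proof.
elim: cs s => // x cs IH s; rewrite pairwise_cons => /andP[/allP hx hcs] hst.
have hst' : forall y (c : 'I_k), y \in cs -> y.2 = c -> s c <= y.1 <= t c.
  by move=> y c hy; apply: hst; rewrite inE hy orbT.
rewrite [map fst _]/= [count _ _]/=; case: (ltnP x.2 k) => xk; last first.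
  exact: leq_trans (IH _ hcs hst') (pack_skip _ _ _ _).
pose c := Ordinal xk; have := hst x c (mem_head _ _) erefl => hc.
apply: leq_trans (pack_take _ hc); rewrite add1n ltnS; apply: IH => // y d hy yd.
have /andP[h1 h2] := hst' y d hy yd.
rewrite ffunE h2 andbT; case: eqP => [dc|//].
by have /implyP := hx _ hy; apply; rewrite yd dc.
Qed.

(** If letters can only weakly increase along cells whose labels strictly
increase, then no colour meets the same label twice.  The vector q records, for
each colour, the first label it may still use. *)
Lemma pack_le_cols J cs s t q :
  pairwise (fun x y => (x.1 <= y.1) ==> (x.2 < y.2)) cs ->
  (forall x, x \in cs -> x.2 < J) ->
  (forall x (c : 'I_k), x \in cs -> s c <= x.1 -> q c <= x.2) ->
  pack (map fst cs) s t <=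
    \sum_(j < J) minn #|[pred c | q c <= j]| (count (fun x => x.2 == j :> nat) cs).
Proof.
elim: cs s q => // x cs IH s q; rewrite pairwise_cons => /andP[/allP hx hcs] hJ hq.
have hJ' : forall y, y \in cs -> y.2 < J by move=> y hy; apply: hJ; rewrite inE hy orbT.
rewrite [map fst _]/=; have [->|[c /andP[h1 h2] ->]] := pack_consP x.1 (map fst cs) s t.
  apply: leq_trans (IH s q hcs hJ' _) _.
    by move=> y c hy; apply: hq; rewrite inE hy orbT.
  by apply: leq_sum => j _ /=; rewrite leq_min geq_minl /= geq_min leq_addl orbT.
have hxJ := hJ _ (mem_head _ _).
(* Colour c may not use the label of x again, which pays for x. *)
pose q' := upd q c x.2.+1.
have hqc := hq x c (mem_head _ _) h1.
apply: (leq_ltn_trans (IH _ q' hcs hJ' _)).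
  move=> y d hy; rewrite !ffunE; case: eqP => [_|_] hd.
    by have /implyP := hx _ hy; apply.
  by apply: hq hd; rewrite inE hy orbT.
rewrite (bigD1 (Ordinal hxJ)) //= [X in _ < X](bigD1 (Ordinal hxJ)) //= eqxx.
rewrite -addSn leq_add //.
  rewrite -minnSS add1n leq_min !geq_min leqnn orbT andbT.
  apply/orP; left; apply: proper_card; apply/properP; split.
    by apply/subsetP => d; rewrite !inE ffunE; case: eqP => [->|//]; rewrite ltnn.
  by exists c; rewrite !inE // ffunE eqxx ltnn.
apply: leq_sum => j _; rewrite leq_min !geq_min leq_addl orbT andbT.
apply/orP; left; apply: subset_leq_card; apply/subsetP => d.
by rewrite !inE ffunE; case: eqP => [->|//]; move=> /ltnW; apply: leq_trans.
Qed.

End Cells.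

(** Tableaux are lists of rows, first row on top; empty rows are harmless and
arise from restriction to small letters. *)
Definition reading (T : seq (seq nat)) := flatten (rev T).

(** Schensted row insertion; writing at position [size R] appends. *)
Fixpoint insert x (T : seq (seq nat)) := if T is R :: T' then
    let i := find (ltn x) R in
    set_nth 0 R i x :: (if i < size R then insert (nth 0 R i) T' else T')
  else [:: [:: x]].

Definition dominates (R S : seq nat) :=
  size S <= size R /\ forall j, j < size S -> nth 0 R j < nth 0 S j.

Fixpoint tableau (T : seq (seq nat)) := if T is R :: T' then
  [/\ sorted leq R, dominates R (head [::] T') & tableau T'] else True.

Lemma reading_cons R T : reading (R :: T) = reading T ++ R.
Proof. by rewrite /reading rev_cons flatten_rcons. Qed.

Lemma congr_ctx u v w x : nat_congr u v -> nat_congr (w ++ u ++ x) (w ++ v ++ x).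
Proof.
move=> uv; apply: congruence_cat; first exact: congruence_refl.
by apply: congruence_cat => //; apply: congruence_refl.
Qed.

Lemma congr_cons a u v : nat_congr u v -> nat_congr (a :: u) (a :: v).
Proof. by move/(congr_ctx [:: a] [::]); rewrite !cats0. Qed.

(** Bumping y by x takes place in two moves: x travels left to the entry y that
it bumps, then y travels left out of the row. *)
Lemma bump_right x y B : x < y -> path leq y B ->
  nat_congr (y :: B ++ [:: x]) [:: y, x & B].
Proof.
elim: B y => [|b B IH] y xy /=; first by move=> _; apply: congruence_refl.
move=> /andP[yb pB]; apply: congruence_trans (congr_cons y (IH b _ pB)) _; first lia.
apply: (@congr_ctx [:: y; b; x] [:: y; x; b] [::] B).
exact/congruence_rel/nat_knuth_bca.
Qed.

Lemma bump_left x y A B : x < y -> sorted leq A -> all (leq^~ x) A ->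
  nat_congr (A ++ [:: y, x & B]) (y :: A ++ x :: B).
Proof.
move=> xy; elim: A => [|a A IH] /=; first by move=> *; apply: congruence_refl.
move=> pA /andP[ax hA]; apply: congruence_trans (congr_cons a (IH (path_sorted pA) hA)) _.
case: A pA hA {IH} => [|h A] pA hA.
  apply: (@congr_ctx [:: a; y; x] [:: y; a; x] [::] B).
  exact/congruence_sym/congruence_rel/nat_knuth_cab.
apply: (@congr_ctx [:: a; y; h] [:: y; a; h] [::] (A ++ x :: B)).
move: pA hA => /= /andP[ah _] /andP[hx _].
by apply/congruence_sym/congruence_rel/nat_knuth_cab => //; lia.
Qed.

Lemma set_nth_split (R : seq nat) i x : i < size R ->
  set_nth 0 R i x = take i R ++ x :: drop i.+1 R.
Proof. by elim: R i => [|a R IH] [|i] //= h; rewrite ?drop0 // IH. Qed.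

Lemma take_find_le x R : all (leq^~ x) (take (find (ltn x) R) R).
Proof. by elim: R => //= a R IH; case: ltnP => //= ->. Qed.

Lemma bump_congr R x (i := find (ltn x) R) : sorted leq R -> i < size R ->
  nat_congr (R ++ [:: x]) (nth 0 R i :: set_nth 0 R i x).
Proof.
move=> sR hi; rewrite set_nth_split //.
have xy : x < nth 0 R i by apply: (@nth_find _ _ (ltn x)); rewrite has_find.
have eR : R = take i R ++ nth 0 R i :: drop i.+1 R by rewrite -drop_nth ?cat_take_drop.
have hA := take_find_le x R; rewrite -/i in hA.
move: eR xy hA sR; set A := take i R; set B := drop i.+1 R; set y := nth 0 R i.
move=> -> xy hA sR; rewrite -catA cat_cons.
have [sA pB] : sorted leq A /\ path leq y B.
  split; first exact: (cat_sorted2 sR).1.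
  by move: sR; rewrite sorted_cat_cons => /andP[].
apply: congruence_trans (bump_left B xy sA hA).
rewrite -[B ++ [:: x]]/(behead (y :: B ++ [:: x])).
by move: (congr_ctx A [::] (bump_right xy pB)); rewrite !cats0.
Qed.

Lemma set_nth_rcons (R : seq nat) x : set_nth 0 R (size R) x = rcons R x.
Proof. by elim: R => //= a R ->. Qed.

Lemma insert_congr x T : tableau T -> nat_congr (reading T ++ [:: x]) (reading (insert x T)).
Proof.
elim: T x => [|R T IH] x; first by move=> _; apply: congruence_refl.
move=> /= [sR _ tT]; rewrite !reading_cons; case: ltnP => hi; last first.
  have -> : find (ltn x) R = size R by apply/eqP; rewrite eqn_leq hi find_size.
  by rewrite set_nth_rcons -catA -cats1; apply: congruence_refl.
rewrite -catA; have := congr_ctx (reading T) [::] (bump_congr sR hi).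
rewrite !cats0 => /congruence_trans; apply; rewrite -cat1s catA.
apply: congruence_cat; first exact: IH.
exact: congruence_refl.
Qed.

Lemma sorted_nth R i j : sorted leq R -> i <= j -> j < size R -> nth 0 R i <= nth 0 R j.
Proof.
move=> sR ij jR; apply: (sorted_leq_nth leq_trans leqnn 0 sR) => //.
by rewrite inE (leq_ltn_trans ij).
Qed.

Lemma nth_before_find x R i : i < find (ltn x) R -> nth 0 R i <= x.
Proof. by move=> h; rewrite leqNgt; apply/negbT/(before_find 0 h). Qed.

Lemma nth_at_find x R : find (ltn x) R < size R -> x < nth 0 R (find (ltn x) R).
Proof. by move=> h; apply: (@nth_find _ 0 (ltn x)); rewrite has_find. Qed.

Lemma sorted_insert x R : sorted leq R -> sorted leq (set_nth 0 R (find (ltn x) R) x).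
Proof.
move=> sR; set i := find _ _; have hi : i <= size R := find_size _ _.
apply/(sortedP 0) => j; rewrite size_set_nth => hj.
rewrite !nth_set_nth /=; case: eqP => [ji|/eqP ji]; case: eqP => [//|/eqP ji1].
- have [h|h] := leqP (size R) j.+1; first by lia.
  apply: ltnW; apply: (@leq_trans (nth 0 R i)).
    by apply: nth_at_find; rewrite -/i; lia.
  by apply: sorted_nth => //; lia.
- by move=> ji1; apply: nth_before_find; rewrite -/i; lia.
by apply: sorted_nth => //; lia.
Qed.

(** The entry bumped into the next row lands weakly to the left of the place it
comes from, since the entry below that place is larger. *)
Lemma dominates_insert x R S : sorted leq R -> dominates R S -> 
  let i := find (ltn x) R in i < size R ->
  let y := nth 0 R i in dominates (set_nth 0 R i x) (set_nth 0 S (find (ltn y) S) y).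
Proof.
move=> sR [hs hd] i hi y; set j := find _ _.
have hj : j <= size S := find_size _ _.
have ji : j <= i.
  rewrite leqNgt; apply/negP => h; have := nth_before_find h.
  by rewrite leqNgt hd //; lia.
have xy : x < y by apply: nth_at_find.
split; first by rewrite !size_set_nth; lia.
move=> q; rewrite size_set_nth !nth_set_nth /= => hq.
case: (q =P j) => [->|/eqP qj].
  case: eqP => [//|/eqP ji']; apply: leq_ltn_trans xy.
  by apply: nth_before_find; rewrite -/i; lia.
have hqS : q < size S by lia.
by case: eqP => [qi|_]; [have := hd _ hqS; rewrite qi -/y; lia|apply: hd].
Qed.

Lemma head_insert x T :
  head [::] (insert x T) = set_nth 0 (head [::] T) (find (ltn x) (head [::] T)) x.
Proof. by case: T. Qed.

Lemma tableau_insert x T : tableau T -> tableau (insert x T).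
Proof.
elim: T x => [|R T IH] x; first by move=> _ /=; split.
move=> /= [sR dR tT]; split; first exact: sorted_insert.
  case: ifP => hi; first by rewrite head_insert; apply: dominates_insert.
  case: dR => h1 h2; have e : find (ltn x) R = size R.
    by apply/eqP; rewrite eqn_leq find_size leqNgt hi.
  split; first by rewrite size_set_nth; lia.
  move=> j hj; rewrite nth_set_nth /= e; case: eqP => [ej|_]; first by lia.
  exact: h2.
by case: ifP => // _; apply: IH.
Qed.

Lemma congr_tableau w : exists2 T, tableau T & nat_congr w (reading T).
Proof.
elim/last_ind: w => [|w x [T tT hT]]; first by exists [::] => //; apply: congruence_refl.
exists (insert x T); first exact: tableau_insert.
apply: congruence_trans (insert_congr x tT); rewrite -cats1.
by apply: congruence_cat => //; apply: congruence_refl.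
Qed.

Lemma congr_perm u v : nat_congr u v -> perm_eq u v.
Proof.
elim=> {u v}.
- by move=> u v [a b c _ _|a b c _ _]; apply/seq.permP => P /=; lia.
- by [].
- by move=> u v _; rewrite perm_sym.
- by move=> v u w _ h1 _ h2; apply: perm_trans h1 h2.
by move=> u u' v v' _ h1 _ h2; apply: perm_cat.
Qed.

(** The reading word with the row and the column of each letter; i is the index
of the top row. *)
Fixpoint cells i (T : seq (seq nat)) : seq (nat * (nat * nat)) :=
  if T is R :: T' then
    cells i.+1 T' ++ [seq (nth 0 R j, (i, j)) | j <- iota 0 (size R)]
  else [::].

Lemma reading_cells i T : reading T = map fst (cells i T).
Proof.
elim: T i => [|R T IH] i //=; rewrite reading_cons map_cat -IH -map_comp; congr (_ ++ _).
by rewrite -[LHS](mkseq_nth 0).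
Qed.

Lemma cells_row i T x : x \in cells i T -> i <= x.2.1.
Proof.
elim: T i => [|R T IH] i //=; rewrite mem_cat => /orP[/IH|/mapP[j _ ->] //].
exact: ltnW.
Qed.

Lemma cells_below i R T x : tableau (R :: T) -> x \in cells i T ->
  x.2.2 < size R /\ nth 0 R x.2.2 < x.1.
Proof.
elim: T i R => [|S T IH] i R //= [sR [h1 h2] [sS dS tT]].
rewrite mem_cat => /orP[hx|/mapP[j hj ->] /=].
  have [|h3 h4] := IH i.+1 S _ hx; first by split.
  by split; [apply: leq_trans h3 h1|apply: ltn_trans h4; apply: h2].
by move: hj; rewrite mem_iota /= => hj; split; [apply: leq_trans hj h1|apply: h2].
Qed.

(** Each row is nondecreasing, and a nondecreasing subsequence of the reading
word moves strictly to the right, because columns strictly increase downwards. *)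
Lemma cells_pairwise i T : tableau T ->
  pairwise (fun x y => ((x.2.1 == y.2.1) ==> (x.1 <= y.1)) &&
                       ((x.1 <= y.1) ==> (x.2.2 < y.2.2))) (cells i T).
Proof.
elim: T i => [|R T IH] i // tRT; move: (tRT) => [sR _ tT] /=.
rewrite pairwise_cat IH //=; apply/andP; split.
  apply/allrelP => x y hx /mapP[j hj ->] /=.
  have := cells_row hx; have [h1 h2] := cells_below tRT hx.
  move: hj; rewrite mem_iota /= => hj ix; apply/andP; split; apply/implyP.
    by move=> /eqP e; rewrite e ltnn in ix.
  move=> h; rewrite ltnNge; apply/negP => h3.
  by move: (leq_trans (leq_ltn_trans (sorted_nth sR h3 h1) h2) h); rewrite ltnn.
rewrite pairwise_map; apply: (@sub_in_pairwise _ [pred j | j < size R] ltn); last first.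
- by rewrite -sorted_pairwise ?iota_ltn_sorted //; apply: ltn_trans.
- by apply/allP => j; rewrite mem_iota.
move=> x y hx hy xy /=; rewrite eqxx (xy : x < y) implybT andbT /=.
by apply: sorted_nth => //; apply: ltnW.
Qed.

Lemma cells_nth i T x : x \in cells i T -> x.1 \in nth [::] T (x.2.1 - i).
Proof.
elim: T i => [|R T IH] i //=; rewrite mem_cat => /orP[hx|/mapP[j hj ->] /=].
  have := IH _ hx; have := cells_row hx; rewrite -subn_gt0 => h.
  by rewrite subnS; case: (x.2.1 - i) h.
by rewrite subnn /=; apply: mem_nth; rewrite mem_iota in hj.
Qed.

Lemma count_row k i T :
  count (fun x => x.2.1 < i + k) (cells i T) = \sum_(j < k) size (nth [::] T j).
Proof.
elim: T i k => [|R T IH] i k /=; first by rewrite big1 // => j _; rewrite nth_nil.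
case: k => [|k].
  rewrite big_ord0; apply/eqP; rewrite -leqn0 leqNgt -has_count; apply/negP => /hasP[x].
  move=> hx; have := @cells_row i (R :: T) x hx; rewrite addn0 => h1 h2.
  by move: (leq_ltn_trans h1 h2); rewrite ltnn.
rewrite big_ord_recl count_cat /= -addSnnS IH addnC; congr (_ + _).
by rewrite count_map (eq_count (a2 := predT)) ?count_predT ?size_iota // => j /=; lia.
Qed.

Lemma count_col j i T :
  count (fun x => x.2.2 == j) (cells i T) = count (fun R => j < size R) T.
Proof.
elim: T i => [|R T IH] i //=; rewrite count_cat IH addnC count_map; congr (_ + _).
rewrite (eq_count (a2 := pred1 j)) // count_uniq_mem ?iota_uniq // mem_iota /= add0n.
by case: ltnP.
Qed.

(** Column j has its cells in the topmost rows. *)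
Lemma minn_col k j T : tableau T ->
  minn k (count (fun R => j < size R) T) <= \sum_(i < k) (j < size (nth [::] T i)).
Proof.
elim: T k => [|R T IH] k /=; first by rewrite minn0.
case: k => [|k]; first by rewrite min0n.
move=> [_ [hd _] tT]; rewrite big_ord_recl /=; case: ltnP => hj /=.
  by rewrite !add1n minnSS ltnS; apply: IH.
rewrite add0n; have -> : count (fun S => j < size S) T = 0; last by rewrite minn0.
elim: T hd tT {IH} => [|S T IH] //= hd [_ [hS _] tT].
by rewrite IH //; lia.
Qed.

Lemma size_cells_col i T x : tableau T -> x \in cells i T -> x.2.2 < size (head [::] T).
Proof.
case: T => // R T tT; rewrite /= mem_cat => /orP[/(cells_below tT)[] //|/mapP[j hj ->]].
by rewrite mem_iota in hj.
Qed.

Section TabPack.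
Variable k : nat.
Implicit Types (s t : {ffun 'I_k -> nat}).

Lemma pack_tableau_ge T s t : tableau T ->
  (forall (c : 'I_k) e, e \in nth [::] T c -> s c <= e <= t c) ->
  \sum_(i < k) size (nth [::] T i) <= pack (reading T) s t.
Proof.
move=> tT h; rewrite (reading_cells 0).
have := @pack_ge_rows k [seq (x.1, x.2.1) | x <- cells 0 T] s t.
rewrite -map_comp count_map -(count_row k 0 T) add0n; apply.
  rewrite pairwise_map; apply: sub_pairwise (cells_pairwise 0 tT) => x y.
  by case/andP.
move=> x c /mapP[y hy ->] /= yc; apply: h; rewrite -yc.
by have := cells_nth hy; rewrite subn0.
Qed.

Lemma pack_tableau_le T s t : tableau T -> pack (reading T) s t <= \sum_(i < k) size (nth [::] T i).
Proof.
move=> tT; rewrite (reading_cells 0).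
have := @pack_le_cols k (size (head [::] T)) [seq (x.1, x.2.2) | x <- cells 0 T] s t (cst k 0).
rewrite -map_comp => /(_ _ _ _)/leq_trans; apply.
- rewrite pairwise_map; apply: sub_pairwise (cells_pairwise 0 tT) => x y.
  by case/andP.
- by move=> x /mapP[y hy ->] /=; apply: size_cells_col hy.
- by move=> x c _ _; rewrite ffunE.
apply: (@leq_trans (\sum_(j < size (head [::] T)) \sum_(i < k) (j < size (nth [::] T i)))).
  apply: leq_sum => j _; rewrite count_map count_col; apply: leq_trans (minn_col k j tT).
  rewrite leq_min geq_min geq_minr andbT; apply/orP; left.
  by apply: leq_trans (max_card _) _; rewrite card_ord.
rewrite exchange_big /=; apply: leq_sum => i _.
elim: (size (head _ _)) => [|J IH]; first by rewrite big_ord0.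
rewrite big_ord_recr /=; set m := size _ in IH *.
have : \sum_(j < J) (j < m) <= J.
  rewrite -[leqRHS]muln1 -[X in X * 1]card_ord -sum_nat_const.
  by apply: leq_sum => j _; case: (j < m).
case: (ltnP J m) => h1 h2; last by rewrite addn0.
by rewrite addn1 (leq_ltn_trans h2).
Qed.

(** Greene's theorem for the reading word of a tableau: the first k rows are an
optimal packing. *)
Lemma pack_tableau T N : tableau T -> all (leq^~ N) (reading T) ->
  pack (reading T) (cst k 0) (cst k N) = \sum_(i < k) size (nth [::] T i).
Proof.
move=> tT hN; apply/eqP; rewrite eqn_leq pack_tableau_le //=; apply: pack_tableau_ge => // c e he.
rewrite !ffunE /=; move/allP: hN; apply; apply/flattenP; exists (nth [::] T c) => //.
rewrite mem_rev; apply: mem_nth; rewrite ltnNge; apply/negP => hc.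
by rewrite nth_default in he.
Qed.

End TabPack.

Lemma tableau_entry b T i e : tableau T -> all (ltn b) (head [::] T) ->
  e \in nth [::] T i -> b + i < e.
Proof.
elim: T b i => [|R T IH] b i; first by rewrite nth_nil.
move=> /= [_ [h1 h2] tT] /allP hR; case: i => [|i] /=.
  by rewrite addn0; apply: hR.
rewrite addnS -addSn; apply: IH => //; apply/allP => f /(nthP 0)[j hj <-].
by apply: leq_ltn_trans (h2 j hj); apply: hR; apply: mem_nth; apply: leq_trans hj h1.
Qed.

Lemma tableau_entry_gt T i e : tableau T -> all (ltn 0) (reading T) -> e \in nth [::] T i -> i < e.
Proof.
move=> tT hT; apply: (@tableau_entry 0) => //; case: T hT {tT} => //= R T.
by rewrite reading_cons all_cat => /andP[].
Qed.

Lemma mem_row T i e : e \in nth [::] T i -> e \in reading T.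
Proof.
move=> he; apply/flattenP; exists (nth [::] T i) => //.
rewrite mem_rev; apply: mem_nth; rewrite ltnNge; apply/negP => hc.
by rewrite nth_default in he.
Qed.

Definition restrict j (T : seq (seq nat)) := [seq filter (leq^~ j) R | R <- T].

Lemma reading_restrict j T : reading (restrict j T) = filter (leq^~ j) (reading T).
Proof. by rewrite /reading /restrict -map_rev filter_flatten. Qed.

Lemma filter_take j R : sorted leq R ->
  filter (leq^~ j) R = take (count (leq^~ j) R) R.
Proof.
elim: R => //= a R IH pR; case: leqP => [aj|ja].
  by rewrite add1n IH // (path_sorted pR).
rewrite add0n; have : all (leq a) R by rewrite order_path_min //; apply: leq_trans.
move=> /allP h; have h0 : count (leq^~ j) R = 0.
  apply/eqP; rewrite -leqn0 leqNgt -has_count; apply/negP => /hasP[x /h].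
  by move=> /= ax xj; move: (leq_trans ja (leq_trans ax xj)); rewrite ltnn.
rewrite h0; apply/eqP; rewrite -size_eq0 size_filter h0; by [].
Qed.

Lemma tableau_restrict j T : tableau T -> tableau (restrict j T).
Proof.
elim: T => [|R T IH] //= [sR dR tT]; split; last exact: IH.
  exact: sorted_filter leq_trans _ _ sR.
case: T dR tT {IH} => [|S T] //= [h1 h2] [sS _ _].
rewrite !filter_take //; have hc : count (leq^~ j) S <= count (leq^~ j) R.
  have hi U : count (leq^~ j) U = count (fun i => nth 0 U i <= j) (iota 0 (size U)).
    by rewrite -{1}(mkseq_nth 0 U) /mkseq count_map.
  rewrite !hi -(subnKC h1) iotaD count_cat; apply: leq_trans (leq_addr _ _).
  rewrite -size_filter -[leqRHS]size_filter; apply: uniq_leq_size.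
    by rewrite filter_uniq ?iota_uniq.
  move=> i; rewrite !mem_filter => /andP[hij hi']; rewrite hi' andbT.
  by apply: leq_trans hij; apply: ltnW; apply: h2; move: hi'; rewrite mem_iota.
split; first by rewrite !size_takel ?count_size.
move=> i; rewrite size_takel ?count_size // => hi.
rewrite !nth_take ?(leq_trans hi) //; apply: h2.
exact: leq_trans hi (count_size _ _).
Qed.

(** A row is determined by the lengths of its restrictions to small letters. *)
Lemma sorted_count_inj R S : sorted leq R -> sorted leq S ->
  (forall j, count (leq^~ j) R = count (leq^~ j) S) -> R = S.
Proof.
move=> sR sS h; apply: (sorted_eq leq_trans anti_leq) => //.
have hp e U : count (leq^~ e) U = count_mem e U + count (ltn^~ e) U.
  by elim: U => //= a U ->; rewrite addnACA leq_eqVlt; case: eqP => [->|]; rewrite ?ltnn.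
apply/allP => e _ /=; have := h e; rewrite !hp.
have -> : count (ltn^~ e) R = count (ltn^~ e) S; last by move/addIn => ->.
case: e => [|e]; last exact: h.
by rewrite (@eq_count _ _ pred0) // (@eq_count _ _ pred0 _ S) // !count_pred0.
Qed.

Lemma nth_restrict j T i : nth [::] (restrict j T) i = filter (leq^~ j) (nth [::] T i).
Proof. by elim: T i => [|R T IH] [|i] //=; apply: IH. Qed.

Lemma congr_filter j u v : nat_congr u v ->
  nat_congr (filter (leq^~ j) u) (filter (leq^~ j) v).
Proof.
elim=> {u v}.
- move=> u v [a b c ab bc|a b c ab bc] /=.
    case: (leqP c j) => cj; case: (leqP b j) => bj; case: (leqP a j) => aj;
    by [apply: congruence_refl|lia|exact/congruence_rel/nat_knuth_bca].
  case: (leqP c j) => cj; case: (leqP b j) => bj; case: (leqP a j) => aj;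
  by [apply: congruence_refl|lia|exact/congruence_rel/nat_knuth_cab].
- by move=> u; apply: congruence_refl.
- by move=> u v _; apply: congruence_sym.
- by move=> v u w _ h1 _; apply: congruence_trans.
by move=> u u' v v' _ h1 _ h2; rewrite !filter_cat; apply: congruence_cat.
Qed.

Lemma reading_nth T U : (forall i, nth [::] T i = nth [::] U i) -> reading T = reading U.
Proof.
elim: T U => [|R T IH] U h.
  elim: U h => // S U IH h; rewrite reading_cons -IH; first by have := h 0.
  by move=> i; have := h i.+1; rewrite !nth_nil.
case: U h => [|S U] h; last first.
  by rewrite !reading_cons (h 0 : R = S) (IH U) // => i; apply: (h i.+1).
rewrite reading_cons (h 0 : R = [::]) cats0 (IH [::]) // => i.
by have := h i.+1; rewrite !nth_nil.
Qed.

(** Only k <= n is needed because a tableau on the letters 1, ..., n has at most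
n rows; row k has length the difference of two consecutive packing numbers. *)
Theorem pack_complete n u v :
  all (fun e => 0 < e <= n) u -> all (fun e => 0 < e <= n) v ->
  (forall k j, k <= n ->
    pack (filter (leq^~ j) u) (cst k 0) (cst k n) =
    pack (filter (leq^~ j) v) (cst k 0) (cst k n)) ->
  nat_congr u v.
Proof.
move=> hu hv h; have [T tT uT] := congr_tableau u; have [U tU vU] := congr_tableau v.
have hT : all (fun e => 0 < e <= n) (reading T) by rewrite -(perm_all _ (congr_perm uT)).
have hU : all (fun e => 0 < e <= n) (reading U) by rewrite -(perm_all _ (congr_perm vU)).
have sum_eq k j : k <= n -> \sum_(i < k) size (nth [::] (restrict j T) i) =
                            \sum_(i < k) size (nth [::] (restrict j U) i).
  have hf W : all (fun e => 0 < e <= n) (reading W) -> all (leq^~ n) (reading (restrict j W)).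
    move=> /allP hW; apply/allP => e; rewrite reading_restrict mem_filter => /andP[_ /hW].
    by case/andP.
  move=> kn; rewrite -!(@pack_tableau k _ n) ?hf //; try exact: tableau_restrict.
  rewrite !reading_restrict -(pack_congr _ _ (congr_filter j uT)) h //.
  exact/pack_congr/congr_filter.
suff e : reading T = reading U.
  by apply: congruence_trans uT _; rewrite e; apply: congruence_sym.
apply: reading_nth => i; have [ni|i_n] := leqP n i.
  have row0 W : tableau W -> all (fun e => 0 < e <= n) (reading W) -> nth [::] W i = [::].
    move=> tW hW; case e : (nth [::] W i) => [//|a A].
    have ha : a \in nth [::] W i by rewrite e mem_head.
    have /andP[_ an] := allP hW _ (mem_row ha).
    have ia : i < a by apply: tableau_entry_gt ha => //; apply: sub_all hW => x /andP[].
    by move: (leq_trans (leq_ltn_trans ni ia) an); rewrite ltnn.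
  by rewrite !row0.
have sT W m : tableau W -> sorted leq (nth [::] W m).
  elim: W m => [|R W IH] [|m] //= [sR _ tW] //; exact: IH.
apply: sorted_count_inj => [||j]; try exact: sT.
have := sum_eq i.+1 j i_n; rewrite !big_ord_recr /= sum_eq 1?ltnW // => /addnI.
by rewrite !nth_restrict !size_filter.
Qed.

Definition low_st k : {ffun 'I_k -> nat} := [ffun c : 'I_k => c.+1].

(** Colour c, counted from 0, may be asked to start at letter c+1 without loss:
on a tableau give it row c, whose entries are at least c+1. *)
Lemma pack_low k N w : all (fun e => 0 < e <= N) w ->
  pack w (low_st k) (cst k N) = pack w (cst k 0) (cst k N).
Proof.
move=> hw; have [T tT wT] := congr_tableau w.
have hT : all (fun e => 0 < e <= N) (reading T) by rewrite -(perm_all _ (congr_perm wT)).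
rewrite !(pack_congr _ _ wT) (@pack_tableau k _ N) //; last by apply: sub_all hT => e /andP[].
apply/eqP; rewrite eqn_leq pack_tableau_le //= pack_tableau_ge // => c e he; rewrite !ffunE.
have /andP[_ ->] := allP hT _ (mem_row he); rewrite andbT.
by apply: tableau_entry_gt he => //; apply: sub_all hT => x /andP[].
Qed.

(** * Reversal, and free boundary conditions *)

Section Rev.
Variables (k N : nat).
Implicit Types (s t : {ffun 'I_k -> nat}).

(** Reversing a word and the order of its letters turns upper bounds into lower
bounds, hence end conditions into starting conditions. *)
Definition revcompl_st s : {ffun 'I_k -> nat} := [ffun c => N - s c].
Definition revcompl w := rev [seq N - e | e <- w].

Lemma revcomplK w : all (leq^~ N) w -> revcompl (revcompl w) = w.
Proof.
move=> /allP h; rewrite /revcompl map_rev revK -map_comp -[RHS]map_id.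
by apply/eq_in_map => e /h /=; lia.
Qed.

Lemma revcompl_cat u v : revcompl (u ++ v) = revcompl v ++ revcompl u.
Proof. by rewrite /revcompl map_cat rev_cat. Qed.

Lemma pack_revcompl w s t : le_st s t -> le_st t (cst k N) ->
  pack w s t <= pack (revcompl w) (revcompl_st t) (revcompl_st s).
Proof.
move=> hst htN; have hN c : t c <= N by have := htN c; rewrite ffunE.
elim: w s hst => // e w IH s hst.
have -> : revcompl (e :: w) = revcompl w ++ [:: N - e] by rewrite /revcompl /= rev_cons cats1.
have [->|[c /andP[h1 h2] ->]] := pack_consP e w s t.
  exact: leq_trans (IH _ hst) (pack_prefix _ _ _ _).
have hu : le_st (upd s c e) t by apply: upd_le.
pose r := revcompl_st (upd s c e).
have hr : le_st r (revcompl_st s).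
  by move=> d; rewrite !ffunE leq_sub2l //; case: eqP => // ->.
apply: (@leq_trans (pack (revcompl w) (revcompl_st t) r + pack [:: N - e] r (revcompl_st s))).
  rewrite -addn1; apply: leq_add; first exact: IH.
  apply: leq_trans (pack_take (c := c) _ _) => //.
  by rewrite !ffunE eqxx leqnn leq_sub2l.
apply: pack_cat_ge => // d.
by rewrite !ffunE leq_sub2l //; have := hu d; rewrite ffunE.
Qed.

Lemma pack_revcompl_cst w : pack w (cst k 0) (cst k N) <= pack (revcompl w) (cst k 0) (cst k N).
Proof.
have e0 : revcompl_st (cst k 0) = cst k N by apply/ffunP => c; rewrite !ffunE subn0.
have eN : revcompl_st (cst k N) = cst k 0 by apply/ffunP => c; rewrite !ffunE subnn.
by rewrite -{2}e0 -{2}eN; apply: pack_revcompl => // c; rewrite !ffunE.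
Qed.
End Rev.

Definition column a k := rev (iota a k).

Lemma mem_column a k e : (e \in column a k) = (a <= e < a + k).
Proof. by rewrite mem_rev mem_iota. Qed.

Lemma column_sorted a k : sorted gtn (column a k).
Proof. by rewrite /column rev_sorted iota_ltn_sorted. Qed.

Lemma nth_column a k i : i < k -> nth 0 (column a k) i = a + (k - i.+1).
Proof. by move=> ik; rewrite nth_rev size_iota // nth_iota //; lia. Qed.

Lemma size_column a k : size (column a k) = k.
Proof. by rewrite size_rev size_iota. Qed.

Lemma revcompl_column n k : k <= n -> revcompl n.+1 (column (n - k).+1 k) = column 1 k.
Proof.
move=> kn; rewrite /revcompl /column map_rev revK; apply: (@eq_from_nth _ 0).
  by rewrite size_map size_rev !size_iota.
move=> i; rewrite size_map size_iota => ik.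
rewrite (nth_map 0) ?size_iota // nth_iota // nth_rev size_iota // nth_iota; lia.
Qed.

Section Column.
Variable k : nat.
Implicit Types (s t : {ffun 'I_k -> nat}).

Lemma gt_sorted_pairwise vs : sorted gtn vs -> pairwise gtn vs.
Proof. by rewrite sorted_pairwise //; move=> x y z /= h1 h2; apply: ltn_trans h2 h1. Qed.

Lemma pack_dec vs s t : sorted gtn vs -> pack vs s t <= k.
Proof.
move=> hs; have := @pack_le_cols k 1 [seq (v, 0) | v <- vs] s t (cst k 0).
rewrite -map_comp map_id => h; apply: leq_trans (h _ _ _) _.
- rewrite pairwise_map; apply: sub_pairwise (gt_sorted_pairwise hs) => x y /=.
  by rewrite ltnNge => /negbTE ->.
- by move=> x /mapP[y _ ->].
- by move=> x c _ _; rewrite ffunE.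
rewrite big_ord_recl big_ord0 addn0 geq_min; apply/orP; left.
by apply: leq_trans (max_card _) _; rewrite card_ord.
Qed.

(** A nondecreasing subsequence meets a strictly decreasing word at most once, so
covering all of such a word takes one colour for each letter. *)
Lemma pack_full (c0 : 'I_k) vs s t : sorted gtn vs -> le_st s t ->
  size vs <= pack vs s t ->
  exists f : nat -> 'I_k, {in gtn (size vs) &, injective f} /\
    forall i, i < size vs -> s (f i) <= nth 0 vs i <= t (f i).
Proof.
elim: vs s => [|v vs IH] s hs hst; first by move=> _; exists (fun=> c0).
have [->|[c /andP[h1 h2] ->]] := pack_consP v vs s t.
  by move=> h; have := leq_trans h (pack_size vs s t); rewrite ltnn.
rewrite ltnS => hsz.
have [f [finj hf]] := IH _ (path_sorted hs) (upd_le hst h2) hsz.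
have hv i : i < size vs -> nth 0 vs i < v.
  move=> hi; have := gt_sorted_pairwise hs; rewrite /= => /andP[/allP h _].
  by apply: h; apply: mem_nth.
have fc i : i < size vs -> f i <> c.
  move=> hi e; have := hf i hi; rewrite e ffunE eqxx => /andP[h _].
  by have := leq_ltn_trans h (hv i hi); rewrite ltnn.
exists (fun i => if i is i'.+1 then f i' else c); split.
  move=> [|i] [|j] //=; rewrite !inE !ltnS => hi hj.
  - by move/esym/fc.
  - by move/fc.
  by move=> e; congr _.+1; apply: finj.
move=> [|i] /=; first by rewrite h1.
rewrite ltnS => hi; have /andP[h3 ->] := hf i hi; rewrite andbT.
by apply: leq_trans h3; apply: le_upd.
Qed.

Lemma perm_of_fun (f : nat -> 'I_k) : {in gtn k &, injective f} ->
  exists p : {perm 'I_k}, forall i : 'I_k, p i = f i.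
Proof.
move=> fi; have hi : injective (fun i : 'I_k => f i).
  by move=> i j /fi h; apply/val_inj/h; rewrite inE ltn_ord.
by exists (perm hi) => i; rewrite permE.
Qed.

(** The state is below a, ..., a+k-1 before a column that is fully covered, and
above it afterwards, up to a permutation of the colours. *)
Lemma column_full a s t : le_st s t -> k <= pack (column a k) s t ->
  exists p : {perm 'I_k}, forall i : 'I_k, s (p i) <= a + i <= t (p i).
Proof.
case: (posnP k) => [k0|k0] hst hk; first by exists 1%g => i; have := ltn_ord i; lia.
have [|f [fi hf]] := pack_full (Ordinal k0) (column_sorted a k) hst; first by rewrite size_column.
rewrite size_column in fi hf.
have [|p hp] := @perm_of_fun (fun i => f (k - i.+1)).
  by move=> i j; rewrite !inE => hi hj /fi; rewrite !inE => h; lia.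
exists p => i; rewrite hp; have := hf (k - i.+1); rewrite nth_column; last by have := ltn_ord i; lia.
have -> : k - (k - i.+1).+1 = i by have := ltn_ord i; lia.
by apply; have := ltn_ord i; lia.
Qed.

Lemma pack_stay w s : injective s -> (forall c, s c \in w) -> k <= pack w s s.
Proof.
move=> si sw; rewrite pack_diag -size_filter -[leqLHS]card_ord -(size_codom s).
apply: uniq_leq_size; first by rewrite map_inj_uniq ?enum_uniq.
by move=> e he; rewrite mem_filter /= he; move/codomP: he => [c ->]; apply: sw.
Qed.

Definition high_st n : {ffun 'I_k -> nat} := [ffun c : 'I_k => (n - k).+1 + c].

(** A word on 1, ..., n loses nothing if its colours have to start from 1, ..., k
and to end below the k largest letters: append the column of these letters.
Read backwards it is the column k, ..., 1, which by [pack_low] can be covered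
entirely on top of an optimal packing; covering it forces the end state. *)
Lemma pack_centre n w : k <= n -> all (fun e => 0 < e <= n) w ->
  exists2 p : {perm 'I_k}, le_st (low_st k) [ffun c => high_st n (p c)] &
    pack w (cst k 0) (cst k n) <= pack w (low_st k) [ffun c => high_st n (p c)].
Proof.
move=> kn hw; set N := n.+1; set Z := column (n - k).+1 k.
have hwN : all (fun e => 0 < e <= N) w.
  by apply: sub_all hw => e /andP[-> h] /=; apply: leqW.
have hwl : all (leq^~ N) w by apply: sub_all hwN => e /andP[].
have hwZ : all (fun e => 0 < e <= N) (w ++ Z).
  by rewrite all_cat hwN; apply/allP => e; rewrite mem_column; lia.
have hwZl : all (leq^~ N) (w ++ Z) by apply: sub_all hwZ => e /andP[].
have hrw : all (fun e => 0 < e <= N) (revcompl N w).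
  apply/allP => e; rewrite mem_rev => /mapP[f hf ->].
  by have := allP hw _ hf; rewrite /N; lia.
(* The alphabet is completed to 0, ..., n+1 so that the complement N - e maps
   1, ..., n to itself. *)
have low : k + pack w (cst k 0) (cst k N) <= pack (w ++ Z) (low_st k) (cst k N).
  rewrite pack_low // -(revcomplK hwZl); apply: leq_trans (pack_revcompl_cst _ _ _).
  rewrite revcompl_cat revcompl_column //.
  apply: leq_trans (pack_cat_ge (r := low_st k) (r' := low_st k) _ _ _ _ _) => //.
  - apply: leq_add.
      apply: leq_trans (pack_mono (s := low_st k) (t := low_st k) _ _ _) => //; last first.
        by move=> c; rewrite ffunE.
      apply: pack_stay => [c d|c]; rewrite !ffunE; first by move=> [] /val_inj.
      by rewrite mem_column; have := ltn_ord c; lia.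
    by rewrite pack_low //; apply: pack_revcompl_cst.
  - by move=> c; rewrite !ffunE; have := ltn_ord c; lia.
  - by move=> c; rewrite !ffunE.
have hfN : le_st (low_st k) (cst k N) by move=> c; rewrite !ffunE; have := ltn_ord c; lia.
have [r [hr1 hr2 hr3]] := pack_cat_le w Z hfN.
have h1 : pack w (low_st k) r <= pack w (cst k 0) (cst k N).
  by rewrite -pack_low //; apply: pack_mono.
have h2 : pack Z r (cst k N) <= k by apply: pack_dec; apply: column_sorted.
have [|p hp] := column_full (a := (n - k).+1) hr2; first by rewrite -/Z; lia.
have hrp : le_st r [ffun c => high_st n ((p^-1)%g c)].
  by move=> c; rewrite !ffunE; have := hp (p^-1%g c); rewrite permKV => /andP[].
exists p^-1%g; first exact: le_st_trans hr1 hrp.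
apply: (@leq_trans (pack w (low_st k) r)); last exact: pack_mono.
apply: (@leq_trans (pack w (cst k 0) (cst k N))); last by lia.
by apply: pack_mono => // c; rewrite !ffunE.
Qed.

End Column.

(** * Words forcing every colour to make one step *)

Lemma leq_count_in (T : eqType) (P Q : pred T) w :
  {in w, forall x, P x -> Q x} -> count P w <= count Q w.
Proof.
elim: w => //= x w IH h; apply: leq_add; last first.
  by apply: IH => y yw; apply: h; rewrite inE yw orbT.
by case: (boolP (P x)) => // /(h _ (mem_head _ _)) ->.
Qed.

Section Gadget.
Variable n : nat.

(** The decreasing word on 0, ..., n with q and q+1 exchanged.  A colour that
stays at one letter covers one occurrence wherever it stays; only a colour
passing from q to q+1 covers two. *)
Definition swapped_column q := column q.+2 (n - q.+1) ++ [:: q, q.+1 & column 0 q].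

(** Successive crossings from j-1 to j, ..., from 0 to 1.  Since the crossings come
in this order, no colour can use two of them. *)
Fixpoint shift_word j := if j is q.+1 then swapped_column q ++ shift_word q else [::].

Lemma sorted_column2 a b c : a <= b -> sorted gtn (column b c ++ column 0 a).
Proof.
move=> ab; rewrite sorted_pairwise; last by move=> x y z /= h1 h2; apply: ltn_trans h2 h1.
rewrite pairwise_cat !gt_sorted_pairwise ?column_sorted // !andbT.
by apply/allrelP => x y; rewrite !mem_column /=; lia.
Qed.

Lemma column0S q : q :: column 0 q = column 0 q.+1.
Proof. by rewrite /column -[in RHS]addn1 iotaD rev_cat. Qed.

Lemma columnS a b : column a.+1 b ++ [:: a] = column a b.+1.
Proof. by rewrite /column /= rev_cons cats1. Qed.

Lemma swapped_del_high q : sorted gtn (column q.+2 (n - q.+1) ++ q :: column 0 q).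
Proof. by rewrite column0S; apply: sorted_column2. Qed.

Lemma swapped_del_low q : sorted gtn (column q.+2 (n - q.+1) ++ q.+1 :: column 0 q).
Proof. by rewrite -cat1s catA columnS; apply: sorted_column2. Qed.

Section States.
Variable k : nat.
Implicit Types (s t : {ffun 'I_k -> nat}).

Lemma swapped_le q s t : pack (swapped_column q) s t <= k.+1.
Proof.
rewrite /swapped_column -cat_rcons; apply: leq_trans (pack_delete _ _ _ _ _) _.
by rewrite ltnS cat_rcons; apply/pack_dec/swapped_del_high.
Qed.

(** Forgetting that the subsequences are disjoint. *)
Lemma pack_sum w s t :
  pack w s t <= \sum_c @pack 1 w (cst 1 (s c)) (cst 1 (t c)).
Proof.
elim: w s => // e w IH s.
have [->|[c hc ->]] := pack_consP e w s t.
  by apply: leq_trans (IH s) _; apply: leq_sum => c _; apply: pack_skip.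
apply: (leq_ltn_trans (IH _)); rewrite (bigD1 c) //= [X in _ < X](bigD1 c) //= ffunE eqxx.
rewrite -addSn; apply: leq_add.
  apply: leq_trans (pack_take (c := ord0) _ _); last by rewrite !ffunE.
  rewrite ltnS; apply: pack_mono => // d; rewrite (ord1 d) !ffunE eqxx //.
by apply: leq_sum => d dc; rewrite ffunE (negbTE dc); apply: pack_skip.
Qed.

Lemma swapped_single q a b :
  @pack 1 (swapped_column q) (cst 1 a) (cst 1 b) <= 1 + ((a <= q) && (q < b)).
Proof.
case: (boolP ((a <= q) && (q < b))) => h; rewrite /swapped_column -cat_rcons.
  apply: leq_trans (pack_delete _ _ _ _ _) _.
  by rewrite ltnS cat_rcons; apply/pack_dec/swapped_del_high.
rewrite addn0; move: h; rewrite negb_and -ltnNge -leqNgt => /orP[h|h].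
  rewrite cat_rcons; apply: leq_trans (pack_drop _ _ _) _.
    by move=> c; rewrite !ffunE negb_and -ltnNge h.
  exact/pack_dec/swapped_del_low.
apply: leq_trans (pack_drop _ _ _) _.
  by move=> c; rewrite !ffunE negb_and -!ltnNge orbC ltnS h.
by rewrite cat_rcons; apply/pack_dec/swapped_del_high.
Qed.

Lemma swapped_gain q s t : k < pack (swapped_column q) s t -> exists2 c, s c <= q & q < t c.
Proof.
move=> h; have [c /andP[h1 h2]|h0] := pickP (fun c => (s c <= q) && (q < t c)).
  by exists c.
have := leq_trans h (pack_sum _ _ _); rewrite ltnNge => /negP[].
rewrite -[leqRHS]card_ord -sum1_card; apply: leq_sum => c _.
by have := swapped_single q (s c) (t c); rewrite h0.
Qed.

(** The gain over k is paid by the motion of the state, so that the gains in any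
number of copies remain bounded. *)
Lemma swapped_pot q s t : le_st s t ->
  pack (swapped_column q) s t + \sum_c s c <= k + \sum_c t c.
Proof.
move=> hst; apply: leq_trans (leq_add (pack_sum _ _ _) (leqnn _)) _.
rewrite -big_split /= -[X in X + _]card_ord -sum1_card -big_split /=.
by apply: leq_sum => c _; have := swapped_single q (s c) (t c); have := hst c; lia.
Qed.

Lemma shift_le j s t : le_st s t -> pack (shift_word j) s t <= j * k.+1.
Proof.
elim: j s => [|j IH] s hst //.
have [r [h1 h2 h3]] := pack_cat_le (swapped_column j) (shift_word j) hst.
by apply: leq_trans h3 _; rewrite mulSn leq_add ?swapped_le ?IH.
Qed.

Lemma shift_pot j s t : le_st s t ->
  pack (shift_word j) s t + \sum_c s c <= j * k + \sum_c t c.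
Proof.
elim: j s => [|j IH] s hst; first by rewrite !add0n; apply: leq_sum => c _.
have [r [h1 h2 h3]] := pack_cat_le (swapped_column j) (shift_word j) hst.
have := swapped_pot j h1; have := IH _ h2; move: h3; rewrite [shift_word j.+1]/= mulSn; lia.
Qed.

(** Covering the maximum forces a gain at each crossing.  The colour crossing
from i to i+1 was at most at i at the beginning, and different crossings use different
colours, since a colour that has reached i+1 cannot cross lower down later. *)
Lemma shift_full (c0 : 'I_k) j s t : le_st s t -> j * k.+1 <= pack (shift_word j) s t ->
  exists f : nat -> 'I_k, {in gtn j &, injective f} /\ forall i, i < j -> s (f i) <= i.
Proof.
elim: j s => [|j IH] s hst; first by exists (fun=> c0).
have [r [h1 h2 h3]] := pack_cat_le (swapped_column j) (shift_word j) hst.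
move=> /leq_trans/(_ h3); rewrite mulSn => h4.
have h5 := swapped_le j s r; have h6 := shift_le j h2.
have [|c cs cr] := @swapped_gain j s r; first by lia.
have [|f [fi hf]] := IH r h2; first by lia.
have fc i : i < j -> f i <> c.
  by move=> hi e; have := hf i hi; rewrite e; lia.
exists (fun i => if i == j then c else f i); split.
  move=> i i'; rewrite !inE !ltnS => hi hi'.
  case: eqP => [->|/eqP ij]; case: eqP => [->|/eqP i'j] //.
  - by move/esym/fc; lia.
  - by move/fc; lia.
  by apply: fi; rewrite inE; lia.
move=> i; rewrite ltnS => hi; case: eqP => [-> //|/eqP ij].
by apply: leq_trans (h1 _) (hf i _); lia.
Qed.

(** The states met by an optimal colouring of a shift word, which starts in
[vac] and ends in [low_st]; [mid j] is reached when the crossings from j upwards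
have been used, by the colours from j upwards. *)
Definition vac : {ffun 'I_k -> nat} := [ffun c : 'I_k => c : nat].
Definition mid j : {ffun 'I_k -> nat} := [ffun c : 'I_k => if c < j then c : nat else c.+1].

Lemma swapped_mid q : q < k -> k <= n -> k < pack (swapped_column q) (mid q.+1) (mid q).
Proof.
move=> qk kn; rewrite /swapped_column -cat_rcons.
have hm : le_st (mid q.+1) (mid q).
  by move=> c; rewrite !ffunE; case: (ltnP c q); case: (ltnP c q.+1) => *; lia.
apply: leq_trans (pack_cat_ge (r := mid q.+1) (r' := mid q) _ _ _ _ _) => //.
rewrite !pack_diag.
(* Apart from the letter q+1, which is not in the state [mid q.+1], that state
   covers k letters; the crossing adds q+1 to them. *)
have h0 : k <= count [in codom (mid q.+1)] (column q.+2 (n - q.+1) ++ q :: column 0 q).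
  rewrite -pack_diag; apply: pack_stay => [c d|c]; rewrite !ffunE.
    by case: (ltnP c q.+1); case: (ltnP d q.+1) => h1 h2 e; apply/val_inj => /=; lia.
  by rewrite mem_cat column0S !mem_column; have := ltn_ord c; case: (ltnP c q.+1) => *; lia.
apply: leq_ltn_trans h0 _; rewrite -cat_rcons count_cat ltn_add2l /=.
rewrite -addn1 addnC leq_add // ?lt0b.
  by apply/codomP; exists (Ordinal qk); rewrite ffunE /= ltnn.
apply: leq_count_in => e; rewrite mem_column => he /codomP[c]; rewrite ffunE => ec.
apply/codomP; exists c; rewrite ffunE ec; move: ec he.
  by case: (ltnP c q.+1); case: (ltnP c q) => *; lia.
Qed.

Lemma shift_mid j : j <= k -> k <= n -> j * k.+1 <= pack (shift_word j) (mid j) (low_st k).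
Proof.
move=> jk kn; elim: j jk => // j IH jk; rewrite mulSn.
apply: leq_trans (pack_cat_ge (r := mid j) (r' := mid j) _ _ _ _ _) => //.
- by apply: leq_add; [apply: swapped_mid|apply: IH; apply: ltnW].
- by move=> c; rewrite !ffunE; case: (ltnP c j) => *; lia.
- by move=> c; rewrite !ffunE; case: (ltnP c j); case: (ltnP c j.+1) => *; lia.
Qed.

Lemma shift_vac : k <= n -> k * k.+1 <= pack (shift_word k) vac (low_st k).
Proof.
move=> kn; apply: leq_trans (shift_mid _ _) _ => //.
by apply: pack_mono => // c; rewrite !ffunE ltn_ord.
Qed.

Lemma shift_stay j s : injective s -> (forall c, s c <= n) -> j <= n ->
  j * k <= pack (shift_word j) s s.
Proof.
move=> si sn; elim: j => // j IH jn; rewrite mulSn.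
apply: leq_trans (pack_cat_ge (r := s) (r' := s) _ _ _ _ _) => //.
apply: leq_add; last by apply: IH; apply: ltnW.
apply: pack_stay => // c; rewrite mem_cat !inE !mem_column; have := sn c; lia.
Qed.

End States.
End Gadget.

(** * Detecting the centre of a frame with one more letter *)

Lemma size_blow b w : size (blow b w) = b * size w.
Proof. by elim: w => [|e w IH]; rewrite ?muln0 //= size_cat size_nseq IH mulnS. Qed.

Definition rep M (u : seq nat) := flatten (nseq M u).

Section Pow.
Variable k : nat.
Implicit Types (s t : {ffun 'I_k -> nat}).

Lemma rep_le M u C : (forall s t, le_st s t -> pack u s t <= C) ->
  forall s t, le_st s t -> pack (rep M u) s t <= M * C.
Proof.
move=> h; elim: M => // M IH s t hst.
have [r [h1 h2 h3]] := pack_cat_le u (rep M u) hst.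
by apply: leq_trans h3 _; rewrite mulSn leq_add ?h ?IH.
Qed.

Lemma rep_stay M u s : pack (rep M u) s s = M * pack u s s.
Proof. by rewrite !pack_diag; elim: M => // M IH; rewrite mulSn -IH -count_cat. Qed.

Lemma rep_pot M u w C :
  (forall s t, le_st s t -> pack u s t + w * \sum_c s c <= C + w * \sum_c t c) ->
  forall s t, le_st s t -> pack (rep M u) s t + w * \sum_c s c <= M * C + w * \sum_c t c.
Proof.
move=> h; elim: M => [|M IH] s t hst.
  by rewrite !add0n leq_mul2l leq_sum ?orbT // => c _.
have [r [h1 h2 h3]] := pack_cat_le u (rep M u) hst.
have := h _ _ h1; have := IH _ _ h2; move: h3; rewrite mulSn.
rewrite -[u ++ rep M u]/(rep M.+1 u); lia.
Qed.

(** As soon as one copy of the column is met by all its letters, the state stays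
above the column for ever; otherwise every copy loses a block of b letters. *)
Lemma rep_column M b a s t : 0 < k -> le_st s t ->
  pack (rep M (blow b (column a k))) s t <= M * (b * k.-1) \/
  exists p : {perm 'I_k}, forall i : 'I_k, a + i <= t (p i).
Proof.
move=> k0; elim: M s => [|M IH] s hst; first by left.
have [r [h1 h2 h3]] := pack_cat_le (blow b (column a k)) (rep M (blow b (column a k))) hst.
have [hk|hk] := leqP k (pack (column a k) s r).
  right; have [p hp] := column_full h1 hk; exists p => i.
  by apply: leq_trans (h2 _); case/andP: (hp i).
case: (IH r h2) => [h4|]; last by right.
left; apply: leq_trans h3 _; rewrite mulSn pack_blow; apply: leq_add => //.
by rewrite leq_mul2l -ltnS prednK ?hk ?orbT.
Qed.

End Pow.

Section Detect.
Variables (n k M : nat) (P T : seq nat).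
Hypotheses (k0 : 0 < k) (kn : k <= n).
Let D := size P + size T.
Let w := D + k * D.
Hypothesis hM : 1 + n + (1 + n) * (n * n) <= M.

(** Weights: D bounds the number of uncontrolled letters of the frame.  Missing a
block of a barrier word costs D letters, missing a crossing of a step word costs
D + k D, as much as everything that can be gained before it, and missing a block
in each of the M barriers after the centre costs as much as all that can be
gained elsewhere, later crossings included. *)
Definition barrier_word D := blow D (column (n - k).+1 k).
Definition step_word D := blow (D + k * D) (shift_word n k).
Let z := barrier_word D.
Let x := step_word D.
Let det c := (P ++ z) ++ x ++ c ++ rep M z ++ rep M x ++ T.
Let A := pack (P ++ z) (cst k 0) (vac k).
Let B := pack (rep M x ++ T) (high_st k n) (cst k n).

Lemma high_le : le_st (high_st k n) (cst k n).
Proof. by move=> c; rewrite !ffunE; have := ltn_ord c; lia. Qed.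

Lemma det_suffix (p : {perm 'I_k}) : M * (D * k) + B <=
  pack (rep M z ++ rep M x ++ T) [ffun c => high_st k n (p c)] (cst k n).
Proof.
set t : {ffun 'I_k -> nat} := [ffun c => _]; have ht : le_st t (cst k n).
  by move=> c; have := high_le (p c); rewrite !ffunE.
apply: leq_trans (pack_cat_ge (r := t) (r' := t) _ _ _ _ _) => //; apply: leq_add.
  rewrite rep_stay pack_blow leq_mul2l leq_mul2l; apply/orP; right; apply/orP; right.
  apply: pack_stay => [c d|c]; rewrite !ffunE; first by move/addnI/val_inj/perm_inj.
  by rewrite mem_column; have := ltn_ord (p c); lia.
rewrite /B -(pack_perm p); apply: pack_mono => // c; by rewrite !ffunE.
Qed.

Lemma det_lower a : all (fun e => 0 < e <= n) a ->
  A + w * (k * k.+1) + pack a (cst k 0) (cst k n) + M * (D * k) + B <=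
    pack (det a) (cst k 0) (cst k n).
Proof.
move=> ha; have [p hp1 hp2] := pack_centre kn ha.
pose t : {ffun 'I_k -> nat} := [ffun c => high_st k n (p c)].
have ht : le_st t (cst k n) by move=> c; have := high_le (p c); rewrite !ffunE.
have hf : le_st (low_st k) (cst k n) by apply: le_st_trans ht.
have hv : le_st (vac k) (low_st k) by move=> c; rewrite !ffunE.
rewrite -!addnA.
apply: leq_trans (pack_cat_ge (r := vac k) (r' := vac k) _ _ _ _ _) => //; last 2 first.
- exact: le_st_trans hf.
- by move=> c; rewrite !ffunE.
rewrite leq_add2l.
apply: leq_trans (pack_cat_ge (r := low_st k) (r' := low_st k) _ _ _ _ _) => //.
apply: leq_add; first by rewrite pack_blow leq_mul2l shift_vac ?orbT.
apply: leq_trans (pack_cat_ge (r := t) (r' := t) _ _ _ _ _) => //.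
by apply: leq_add => //; apply: det_suffix.
Qed.

(** A motionless state covers k letters of each swapped column wherever it is,
and this is also the bulk of the maximum, up to the bounded gains: see
[tail_le]. *)
Lemma B_ge : M * (w * (k * k)) <= B.
Proof.
apply: leq_trans (pack_prefix _ _ _ _); apply: leq_trans (pack_mono _ _ high_le) => //.
rewrite rep_stay pack_blow -/w !leq_mul2l shift_stay ?orbT //.
  by move=> c d; rewrite !ffunE => /addnI/val_inj.
by move=> c; have := high_le c; rewrite !ffunE.
Qed.

Lemma tail_le s : le_st s (cst k n) ->
  pack (rep M x ++ T) s (cst k n) <= B + w * (k * n) + size T.
Proof.
move=> hs; have [r [h1 h2 h3]] := pack_cat_le (rep M x) T hs.
apply: leq_trans h3 _; apply: leq_add; last exact: pack_size.
have := @rep_pot k M x w (w * (k * k)); move/(_ _ s r h1) => h.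
apply: (@leq_trans (M * (w * (k * k)) + w * (\sum_c r c))).
  apply: leq_trans (leq_addr (w * \sum_c s c) _) _; apply: h => s' t' hst.
  by rewrite pack_blow -!mulnDr leq_mul2l shift_pot ?orbT.
apply: leq_add; first exact: B_ge.
rewrite leq_mul2l; apply/orP; right; rewrite -[X in X * n](card_ord k) -sum_nat_const.
by apply: leq_sum => c _; have := h2 c; rewrite ffunE.
Qed.

(** The colouring is cut at the ends of the barrier, of the step word, of the
centre and of the repeated barriers.  If the repeated barriers do not force the
final state, or if some crossing of the step word is not used, the loss is at
least any possible gain; otherwise both sides are bounded by their optimum under the
boundary conditions used in [det_lower]. *)
Lemma det_upper b :
  pack (det b) (cst k 0) (cst k n) <=
  A + w * (k * k.+1) + pack b (cst k 0) (cst k n) + M * (D * k) + B.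
Proof.
have h0n : le_st (cst k 0) (cst k n) by move=> c; rewrite !ffunE.
have [s1 [h01 h1n e1]] := pack_cat_le (P ++ z) (x ++ b ++ rep M z ++ rep M x ++ T) h0n.
have [s2 [h12 h2n e2]] := pack_cat_le x (b ++ rep M z ++ rep M x ++ T) h1n.
have [s3 [h23 h3n e3]] := pack_cat_le b (rep M z ++ rep M x ++ T) h2n.
have [s4 [h34 h4n e4]] := pack_cat_le (rep M z) (rep M x ++ T) h3n.
have f1 : pack (P ++ z) (cst k 0) s1 <= size P + D * k.
  by apply: leq_trans (pack_size _ _ _) _; rewrite size_cat size_blow size_column.
have f2 : pack x s1 s2 <= w * (k * k.+1).
  by rewrite pack_blow leq_mul2l shift_le ?orbT.
have f3 : pack b s2 s3 <= pack b (cst k 0) (cst k n).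
  by apply: pack_mono => // c; rewrite !ffunE.
have f4 : pack (rep M z) s3 s4 <= M * (D * k).
  apply: rep_le => // s t hst; rewrite pack_blow leq_mul2l; apply/orP; right.
  exact/pack_dec/column_sorted.
have hk1 : D * k = D * k.-1 + D by rewrite -mulnSr prednK.
have [g4|[p hp]] := rep_column M D (n - k).+1 k0 h34.
  have f5 := tail_le h4n.
  (* M barriers with a missing block each lose M * D, at least what can be gained
     elsewhere. *)
  have hD : size P + D * k + w * (k * n) + size T <= M * D.
    apply: (@leq_trans ((1 + n + (1 + n) * (n * n)) * D)); last by rewrite leq_mul2r hM orbT.
    have : (1 + k + (1 + k) * (k * n)) * D <= (1 + n + (1 + n) * (n * n)) * D.
      by rewrite leq_mul2r !leq_add ?leq_mul ?orbT.
    apply: leq_trans; rewrite /w /D; lia.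
  have : M * (D * k) = M * (D * k.-1) + M * D by rewrite hk1 mulnDr.
  by move: g4; rewrite -/(barrier_word D) -/z; move: e1 e2 e3 e4; rewrite /det; lia.
have f5 : pack (rep M x ++ T) s4 (cst k n) <= B.
  rewrite -(pack_perm p _ s4); apply: pack_mono => c; rewrite !ffunE //.
have [hx|hx] := leqP (k * k.+1) (pack (shift_word n k) s1 s2); last first.
  have : pack x s1 s2 + w <= w * (k * k.+1).
    by rewrite pack_blow -mulnSr leq_mul2l hx orbT.
  have : size P + D * k <= w by rewrite /w /D; lia.
  by move: e1 e2 e3 e4; rewrite /det; lia.
have [f [fi hf]] := shift_full (Ordinal k0) h12 hx.
have [q hq] := perm_of_fun fi.
have : pack (P ++ z) (cst k 0) s1 <= A.
  rewrite -(pack_perm q _ _ s1); apply: pack_mono => c; rewrite !ffunE //.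
  by rewrite hq hf.
by move: e1 e2 e3 e4; rewrite /det; lia.
Qed.

(** The optimum of a frame is a constant plus the optimum of its centre. *)
Lemma detect a b : all (fun e => 0 < e <= n) a ->
  pack b (cst k 0) (cst k n) < pack a (cst k 0) (cst k n) ->
  pack (det b) (cst k 0) (cst k n) < pack (det a) (cst k 0) (cst k n).
Proof.
move=> ha hab; apply: leq_ltn_trans (det_upper b) _; apply: leq_trans (det_lower ha).
by rewrite !ltn_add2r ltn_add2l.
Qed.

End Detect.

(** * The ladder of identities *)

Definition extend (T T' : Type) (f : T -> seq T') (w : seq T) := flatten [seq f i | i <- w].

Lemma extend_cat T T' (f : T -> seq T') u v : extend f (u ++ v) = extend f u ++ extend f v.
Proof. by rewrite /extend map_cat flatten_cat. Qed.

Lemma extend_eq (f g : nat -> seq nat) w : {in w, f =1 g} -> extend f w = extend g w.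
Proof. by move=> h; rewrite /extend; congr flatten; apply/eq_in_map. Qed.

Lemma extend_nseq (f : nat -> seq nat) M i : extend f (nseq M i) = rep M (f i).
Proof. by elim: M => //= M IH; rewrite -[LHS]/(f i ++ extend f (nseq M i)) IH. Qed.

Lemma extend_rep (f : nat -> seq nat) M w : extend f (rep M w) = rep M (extend f w).
Proof. by elim: M => //= M IH; rewrite -[LHS]/(extend f (w ++ rep M w)) extend_cat IH. Qed.

Lemma count_rep P M w : count P (rep M w) = M * count P w.
Proof. by elim: M => // M IH; rewrite mulSn -IH -count_cat. Qed.

Section HideStep.
Variables (k h M : nat) (a b p1 p2 q1 q2 : seq nat).
Implicit Types s t : {ffun 'I_k -> nat}.
Let p := p1 ++ a ++ p2.
Let q := q1 ++ a ++ q2.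
Hypothesis M0 : 0 < M.
Hypothesis ab : perm_eq a b.
Hypothesis IH : forall s t, le_st s t -> \sum_c t c <= \sum_c s c + h ->
  pack a s t <= pack b s t.
Hypothesis balance : forall P : pred nat,
  count P q1 + count P a = M * (count P a + count P p2).

(** If the state makes all of its h+1 steps inside the central copy of a, it is
motionless outside.  Executing these steps in the copy of a on the left, or in
the one on the right, changes the number of covered letters by a multiple of the
same number, once positive and once negative, by the balance hypothesis. *)
Lemma hide_step s t : le_st s t -> \sum_c t c <= \sum_c s c + h.+1 ->
  pack (p ++ a ++ q) s t <= pack (p ++ b ++ q) s t.
Proof.
move=> hst hsum.
have [s' [h1 h2 e1]] := pack_cat_le p (a ++ q) hst.
have [t' [h3 h4 e2]] := pack_cat_le a q h2.
have eq_sum (u v : {ffun 'I_k -> nat}) : le_st u v -> \sum_c v c <= \sum_c u c -> u = v.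
  move=> uv huv; apply/ffunP => c; have := uv c.
  have : \sum_(d | d != c) u d <= \sum_(d | d != c) v d by apply: leq_sum.
  by move: huv; rewrite (bigD1 c) //= [\sum_d u d](bigD1 c) //=; lia.
have sum_le (u v : {ffun 'I_k -> nat}) : le_st u v -> \sum_c u c <= \sum_c v c.
  by move=> uv; apply: leq_sum.
have cat3 u v w r1 r2 : le_st s r1 -> le_st r1 r2 -> le_st r2 t ->
    pack u s r1 + pack v r1 r2 + pack w r2 t <= pack (u ++ v ++ w) s t.
  move=> g1 g2 g3; rewrite -addnA; have g4 : le_st r1 t by apply: le_st_trans g3.
  apply: leq_trans (pack_cat_ge (r := r1) (r' := r1) _ _ _ _ _) => //.
  rewrite leq_add2l.
  by apply: leq_trans (pack_cat_ge (r := r2) (r' := r2) _ _ _ _ _).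
apply: leq_trans e1 _; apply: leq_trans (leq_add (leqnn _) e2) _; rewrite addnA.
have [hs'|hs'] := leqP (\sum_c t' c) (\sum_c s' c + h).
  apply: leq_trans (cat3 _ _ _ _ _ h1 h3 h4).
  by rewrite leq_add2r leq_add2l IH.
have sl1 := sum_le _ _ h1; have sl2 := sum_le _ _ h4.
have es : s = s' by apply: eq_sum => //; lia.
have et : t' = t by apply: eq_sum => //; lia.
subst s' t'; rewrite !pack_diag.
have cab u := seq.permP ab u.
(* The state jumps from s to t in the left copy of a, or in the right one. *)
have left_ : pack p1 s s + pack a s t + pack (p2 ++ b ++ q) t t <= pack (p ++ b ++ q) s t.
  by rewrite /p -!catA; apply: cat3.
have right_ : pack (p ++ b ++ q1) s s + pack a s t + pack q2 t t <= pack (p ++ b ++ q) s t.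
  by have := cat3 (p ++ b ++ q1) a q2 s t; rewrite -!catA /q; apply.
have bs := balance [in codom s]; have bt := balance [in codom t].
move: left_ right_; rewrite !pack_diag /p /q !count_cat -!cab.
move: bs bt; set ds := count _ a; set dt := count _ a.
have [hh|hh] := leqP (ds + count [in codom s] p2) (dt + count [in codom t] p2).
  by lia.
have : M * (dt + count [in codom t] p2) <= M * (ds + count [in codom s] p2).
  by rewrite leq_mul2l (ltnW hh) orbT.
move=> h5 bs bt _; rewrite -bs -bt in h5.
by move/(leq_trans _); apply; move: h5; clear;
  move: (pack a s t) (count _ q1) (count _ q1) => m m1 m2; lia.
Qed.

End HideStep.

(** The repetitions at the end place a copy of b, and further on a copy of a, at
M times the displacement that separates the centre from the copy of the same word
at the beginning. *)
Definition frame M z x (a b c : seq nat) :=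
  ((a ++ b) ++ [:: z]) ++ [:: x] ++ c ++ nseq M z ++ nseq M x ++
    (rep M.-1 a ++ b ++ rep M a).

Fixpoint ladder M h : seq nat * seq nat :=
  if h is g.+1 then
    let: (a, b) := ladder M g in
    (frame M g.*2.+2 g.*2.+3 a b a, frame M g.*2.+2 g.*2.+3 a b b)
  else ([:: 0; 1], [:: 1; 0]).

Lemma extend_perm (f : nat -> seq nat) u v : perm_eq u v -> perm_eq (extend f u) (extend f v).
Proof. by move=> uv; apply/perm_flatten/perm_map. Qed.

Lemma repS M u : rep M.+1 u = rep M u ++ u.
Proof.
elim: M => [|M IH]; first by rewrite /rep /= cats0.
by rewrite -[LHS]/(u ++ rep M.+1 u) {1}IH catA.
Qed.

Lemma ladder_perm M h : perm_eq (ladder M h).1 (ladder M h).2.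
Proof.
elim: h => // h; rewrite /=; case: (ladder M h) => a b /= ab.
by rewrite /frame !perm_cat2l perm_cat2r.
Qed.

(** Rung h cannot be seen by colourings whose state makes at most h unit steps. *)
Lemma pack_ladder f M k h (s t : {ffun 'I_k -> nat}) : 0 < M -> le_st s t ->
  \sum_c t c <= \sum_c s c + h ->
  pack (extend f (ladder M h).1) s t = pack (extend f (ladder M h).2) s t.
Proof.
move=> M0; elim: h s t => [|h IH] s t hst hsum.
  have -> : t = s.
    apply/ffunP => c; have := hst c.
    have : \sum_(d | d != c) s d <= \sum_(d | d != c) t d by apply: leq_sum.
    by move: hsum; rewrite addn0 (bigD1 c) //= [\sum_d s d](bigD1 c) //=; lia.
  by rewrite !pack_diag; apply/seq.permP/extend_perm.
have := extend_perm f (ladder_perm M h); move: IH; rewrite [ladder M h.+1]/=.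
case: (ladder M h) => a b /=; set a' := extend f a; set b' := extend f b => IH ab.
have e c : extend f (frame M h.*2.+2 h.*2.+3 a b c) =
    (a' ++ b' ++ f h.*2.+2 ++ f h.*2.+3) ++ extend f c ++
    rep M (f h.*2.+2) ++ rep M (f h.*2.+3) ++ rep M.-1 a' ++ b' ++ rep M a'.
  by rewrite /frame !extend_cat !extend_nseq !extend_rep /extend /= !cats0 -!catA.
rewrite !e {e}; set z := f _; set x := f _.
have cab P := seq.permP ab P.
have eM m : M * m = M.-1 * m + m by rewrite -mulSnr prednK.
apply/eqP; rewrite eqn_leq; apply/andP; split.
  have := @hide_step k h M a' b' [::] (b' ++ z ++ x)
    (rep M z ++ rep M x ++ rep M.-1 a' ++ b' ++ rep M.-1 a') [::] M0 ab.
  rewrite cats0 -!catA -repS prednK //; apply=> // [s' t' h1 h2|P]; first by rewrite IH.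
  rewrite !count_cat !count_rep -(cab P) !eM.
  by move: (count P a') (count P z) (count P x) => *; lia.
have := @hide_step k h M b' a' a' (z ++ x) (rep M z ++ rep M x ++ rep M.-1 a')
   (rep M a') M0; rewrite perm_sym => /(_ ab).
rewrite -!catA; apply=> // [s' t' h1 h2|P]; first by rewrite IH.
rewrite !count_cat !count_rep -!(cab P) !eM.
by move: (count P a') (count P z) (count P x) => *; lia.
Qed.

(** * From the ladder to the plactic monoids *)

Local Open Scope quotient_scope.

(** The ratio of displacements has to be large enough for [detect], for every
k <= n. *)
Definition ratio n := 1 + n + (1 + n) * (n * n).

Definition ladder_holds n h := forall f : nat -> seq nat,
  (forall i, all (fun e => 0 < e <= n) (f i)) ->
  nat_congr (extend f (ladder (ratio n) h).1) (extend f (ladder (ratio n) h).2).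

Lemma filter_extend P (f : nat -> seq nat) w : filter P (extend f w) = extend (filter P \o f) w.
Proof. by rewrite /extend filter_flatten -map_comp. Qed.

Lemma all_extend P (f : nat -> seq nat) w : (forall i, all P (f i)) -> all P (extend f w).
Proof.
move=> h; elim: w => //= i w.
by rewrite -[extend f (i :: w)]/(f i ++ extend f w) all_cat h.
Qed.

(** A state of k <= n colours makes at most n steps for each colour. *)
Lemma ladder_holds_top n : ladder_holds n (n * n).
Proof.
move=> f hf; apply: (@pack_complete n); try exact: all_extend.
move=> k j kn; rewrite !filter_extend; apply: (@pack_ladder _ (ratio n) k (n * n)) => //.
  by move=> c; rewrite !ffunE.
rewrite (eq_bigr (fun=> n)) => [|c _]; last by rewrite ffunE.
by rewrite sum_nat_const card_ord; apply: leq_trans (leq_addl _ _); rewrite leq_mul2r kn orbT.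
Qed.

Lemma ladder_letters M h :
  all (gtn h.*2.+2) (ladder M h).1 && all (gtn h.*2.+2) (ladder M h).2.
Proof.
elim: h => // h /=; case: (ladder M h) => a b /= /andP[ha hb].
have all_pw m u : all (gtn h.+1.*2.+2) u -> all (gtn h.+1.*2.+2) (rep m u).
  by move=> hu; elim: m => //= m IH; rewrite -[rep m.+1 u]/(u ++ rep m u) all_cat hu.
have ha' : all (gtn h.+1.*2.+2) a by apply: sub_all ha => i /=; lia.
have hb' : all (gtn h.+1.*2.+2) b by apply: sub_all hb => i /=; lia.
have hz : h.*2.+2 < h.+1.*2.+2 by lia.
have hx : h.*2.+3 < h.+1.*2.+2 by lia.
by rewrite /frame !all_cat !all_pw //= !ha' !hb' !all_nseq /= hz hx !orbT.
Qed.

Lemma mem_blow b w e : e \in blow b w -> e \in w.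
Proof. by move=> /flatten_mapP[f fw]; rewrite mem_nseq => /andP[_ /eqP ->]. Qed.

Lemma mem_shift n j e : j <= n -> e \in shift_word n j -> e <= n.
Proof.
elim: j => // j IH jn; rewrite mem_cat => /orP[|]; last by apply: IH; lia.
by rewrite mem_cat !inE !mem_column; lia.
Qed.

(** The letters 0, ..., n are those of rank n+1. *)
Definition separates n h :=
  exists2 f : nat -> seq nat, forall i, all (leq^~ n) (f i) &
  exists k, pack (extend f (ladder (ratio n) h).1) (cst k 0) (cst k n) <>
            pack (extend f (ladder (ratio n) h).2) (cst k 0) (cst k n).

(** A failing substitution f is first restricted to the letters up to some j, so
that the failure is visible on an unrestricted packing number; the two new
letters of the next rung are then sent to the barrier and step words. *)
Lemma ladder_fails_next n h : ~ ladder_holds n h -> separates n h.+1.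
Proof.
move=> nh.
have [f [hf nc]] : exists f : nat -> seq nat, (forall i, all (fun e => 0 < e <= n) (f i)) /\
   ~ nat_congr (extend f (ladder (ratio n) h).1) (extend f (ladder (ratio n) h).2).
  apply: contrapT => h0; apply: nh => f hf; apply: contrapT => nc; apply: h0.
  by exists f.
have [k [j [kn neq]]] : exists k j, k <= n /\
   pack (extend (filter (leq^~ j) \o f) (ladder (ratio n) h).1) (cst k 0) (cst k n) <>
   pack (extend (filter (leq^~ j) \o f) (ladder (ratio n) h).2) (cst k 0) (cst k n).
  apply: contrapT => h0; apply: nc; apply: (@pack_complete n); try exact: all_extend.
  move=> k j kn; rewrite !filter_extend; apply: contrapT => neq; apply: h0.
  by exists k, j.
pose g : nat -> seq nat := filter (leq^~ j) \o f.
have hg i : all (fun e => 0 < e <= n) (g i).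
  by apply/allP => e; rewrite mem_filter => /andP[_]; apply: (allP (hf i)).
have k0 : 0 < k.
  rewrite lt0n; apply/eqP => k0; apply: neq; move: {kn} k k0 => _ ->.
  have p0 w s t : @pack 0 w s t = 0.
    by apply/eqP; rewrite -leqn0; apply: leq_trans (pack_sum _ _ _) _; rewrite big_ord0.
  by rewrite !p0.
have hlev := ladder_letters (ratio n) h.
have epair : ladder (ratio n) h = ((ladder (ratio n) h).1, (ladder (ratio n) h).2) by case: ladder.
move: neq hlev; rewrite /separates [ladder _ h.+1]/= epair -/g /=.
set a := (ladder _ h).1; set b := (ladder _ h).2 => neq /andP[ha hb].
pose P := extend g (a ++ b); pose T := extend g (rep (ratio n).-1 a ++ b ++ rep (ratio n) a).
pose D := size P + size T.
pose F i := if i == h.*2.+2 then barrier_word n k D else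
            if i == h.*2.+3 then step_word n k D else g i.
exists F.
  have le_g i : all (leq^~ n) (g i) by apply: sub_all (hg i) => e /andP[].
  move=> i; rewrite /F; case: eqP => _; last case: eqP => _ //.
    by apply/allP => e /mem_blow; rewrite mem_column; lia.
  by apply/allP => e /mem_blow; apply: mem_shift.
exists k.
have eF w : all (gtn h.*2.+2) w -> extend F w = extend g w.
  move=> /allP hw; apply: extend_eq => i /hw /= hi; rewrite /F.
  by case: eqP => [|_]; [lia|case: eqP => [|_]; [lia|]].
have eF' w : w = a \/ w = b -> extend F (frame (ratio n) h.*2.+2 h.*2.+3 a b w) =
   (P ++ barrier_word n k D) ++ step_word n k D ++ extend g w ++ rep (ratio n) (barrier_word n k D) ++
      rep (ratio n) (step_word n k D) ++ T.
  move=> hw; have aw : all (gtn h.*2.+2) w by case: hw => ->.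
  have ez : F h.*2.+2 = barrier_word n k D by rewrite /F eqxx.
  have ex : F h.*2.+3 = step_word n k D.
    by rewrite /F eqxx; case: eqP => // /eqP; rewrite eqn_leq ltnn.
  have e1 i : extend F [:: i] = F i by rewrite /extend /= cats0.
  by rewrite /frame /P /T !extend_cat !extend_nseq !extend_rep !e1 ez ex
     (eF _ ha) (eF _ hb) (eF _ aw).
rewrite (eF' a) ?(eF' b); [|by right|by left].
have hM : 1 + n + (1 + n) * (n * n) <= ratio n by [].
have hdet := @detect n k (ratio n) P T k0 kn hM.
have ga : all (fun e => 0 < e <= n) (extend g a) by apply: all_extend.
have gb : all (fun e => 0 < e <= n) (extend g b) by apply: all_extend.
move/eqP: neq; rewrite neq_ltn => /orP[hlt|hlt] e.
  by have := hdet _ _ gb hlt; rewrite e ltnn.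
by have := hdet _ _ ga hlt; rewrite e ltnn.
Qed.

Lemma ladder_fails0 n : 0 < n -> separates n 0.
Proof.
move=> n0; exists (fun i => [:: minn i 1]) => [i|]; first by rewrite /= andbT; lia.
exists 1.
have h2 : 2 <= pack [:: 0; 1] (cst 1 0) (cst 1 n).
  apply: leq_trans (pack_take (c := ord0) _ _) => //; last by rewrite !ffunE.
  rewrite ltnS; apply: leq_trans (pack_take (c := ord0) _ _) => //.
  by rewrite !ffunE eqxx.
have h1 : pack [:: 1; 0] (cst 1 0) (cst 1 n) <= 1 by apply: pack_dec.
rewrite -[extend _ (ladder _ _).1]/[:: 0; 1] -[extend _ (ladder _ _).2]/[:: 1; 0] => e.
by rewrite e in h2; have := leq_trans h2 h1.
Qed.

Lemma congr_val n (u v : seq 'I_n) : congruence (@knuth n) u v ->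
  nat_congr (map val u) (map val v).
Proof.
elim=> {u v}.
- by move=> u v [a b c ? ?|a b c ? ?]; apply: congruence_rel;
    [exact: nat_knuth_bca|exact: nat_knuth_cab].
- by move=> u; apply: congruence_refl.
- by move=> u v _; apply: congruence_sym.
- by move=> v u w _ h1 _; apply: congruence_trans.
by move=> u u' v v' _ h1 _ h2; rewrite !map_cat; apply: congruence_cat.
Qed.

(** In rank n the letters 1, ..., n stand for the ordinals 0, ..., n-1, which
leaves the natural number 0 free for rank n+1, where letters are the values of
the ordinals. *)
Definition pred_ord n (e : nat) : 'I_n.+1 := inord e.-1.

Lemma congr_down n u v : nat_congr u v -> all (fun e => 0 < e <= n.+1) u ->
  congruence (@knuth n.+1) (map (@pred_ord n) u) (map (@pred_ord n) v).
Proof.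
elim=> {u v}.
- have dv e : 0 < e <= n.+1 -> val (pred_ord n e) = e.-1 by move=> h; rewrite /= inordK; lia.
  move=> u v [a b c ab bc|a b c ab bc] /=; rewrite andbT => /and3P[h1 h2 h3];
    apply: congruence_rel; [apply: knuth_bca|apply: knuth_cab];
    rewrite -[nat_of_ord _]/(val _) -[X in _ <= X]/(val _) !dv //; lia.
- by move=> u _; apply: congruence_refl.
- move=> u v uv IH hv; apply: congruence_sym; apply: IH.
  by rewrite (perm_all _ (congr_perm uv)).
- move=> v u w uv h1 _ h2 hu; apply: congruence_trans (h1 hu) (h2 _).
  by rewrite -(perm_all _ (congr_perm uv)).
move=> u u' v v' _ h1 _ h2; rewrite all_cat !map_cat => /andP[hu hv].
by apply: congruence_cat; [apply: h1|apply: h2].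
Qed.

Section Morphism.
Variables (A T : choiceType) (R : seq T -> seq T -> Prop).

Definition subst (f : A -> seq T) (w : free_semigroup A) : presented_monoid R :=
  \pi_(presented_monoid R) (extend f w).

Lemma pi_catE (u v : seq T) : \pi_(presented_monoid R) (u ++ v) =
  ((\pi_(presented_monoid R) u : presented_monoid R) * \pi_(presented_monoid R) v)%g.
Proof. exact: pi_cat. Qed.

Lemma substM (f : A -> seq T) : {morph subst f : u v / (u * v)%g}.
Proof. by move=> u v; rewrite /subst -pi_catE -extend_cat. Qed.

HB.instance Definition _ (f : A -> seq T) :=
  isMultiplicative.Build (free_semigroup A) (presented_monoid R) (subst f) (substM f).

Definition single (i : A) : free_semigroup A := @FreeSemigroup A [:: i] isT.

(** Every morphism to a presented monoid is a substitution of words. *)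
Lemma mult_subst (F : {multiplicative free_semigroup A -> presented_monoid R}) w :
  F w = \pi_(presented_monoid R) (extend (fun i => generic_quotient.repr (F (single i))) w).
Proof.
case: w => w hw; case: w hw => // i w; elim: w i => [|j w IH] i hw.
  rewrite /extend /= cats0 reprK; congr (F _); exact: val_inj.
have -> : FreeSemigroup hw = (single i * @FreeSemigroup A (j :: w) isT)%g by apply: val_inj.
rewrite gmulfM (IH j isT) -[letters (_ * _)%g]/([:: i] ++ j :: w) extend_cat pi_catE; congr (_ * _)%g.
by rewrite /extend /= cats0 reprK.
Qed.

End Morphism.

Section Identity.
Variables M h : nat.
Let N := h.*2.+1.
Definition ladder_word (w : seq nat) : seq 'I_N.+1 := map (@inord N) w.

Lemma val_ladder_word w : all (gtn N.+1) w -> map val (ladder_word w) = w.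
Proof.
move=> /allP hw; rewrite /ladder_word -map_comp -[RHS]map_id; apply/eq_in_map => i /hw hi.
by rewrite /= inordK.
Qed.

Lemma ladder_neq0 : ~~ nilp (ladder_word (ladder M h).1) && ~~ nilp (ladder_word (ladder M h).2).
Proof.
rewrite /nilp !size_map; case: h => // g /=; case: (ladder M g) => a b /=.
by rewrite /frame !size_cat /=; lia.
Qed.

Definition ladder_lhs := FreeSemigroup (proj1 (andP ladder_neq0)).
Definition ladder_rhs := FreeSemigroup (proj2 (andP ladder_neq0)).

Lemma ladder_valE : map val (letters ladder_lhs) = (ladder M h).1 /\
                 map val (letters ladder_rhs) = (ladder M h).2.
Proof. by have /andP[h1 h2] := ladder_letters M h; split; apply: val_ladder_word. Qed.

Lemma extend_ladder (T : Type) (f : nat -> seq T) :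
  extend (fun i : 'I_N.+1 => f i) ladder_lhs = extend f (ladder M h).1 /\
  extend (fun i : 'I_N.+1 => f i) ladder_rhs = extend f (ladder M h).2.
Proof. by have [<- <-] := ladder_valE; rewrite /extend -!map_comp. Qed.
End Identity.

Lemma exists_identity n h : 0 < n -> ladder_holds n h -> separates n h ->
  exists e : semigroup_identity,
    satisfies (plactic n) e /\ ~ satisfies (plactic n.+1) e.
Proof.
move=> n0 hol [f hf [k neq]].
have ne : ladder_lhs (ratio n) h <> ladder_rhs (ratio n) h.
  move=> e; apply: neq; have [<- <-] := extend_ladder (ratio n) h f; by rewrite e.
exists (SemigroupIdentity ne); split.
  case: n n0 hol {f hf neq} ne => // n _ hol ne F; rewrite !(mult_subst F) /=.
  set g := fun i => _; apply/pi_eqP.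
  pose up (u : seq 'I_n.+1) := [seq (nat_of_ord i).+1 | i <- u].
  have upK u : map (@pred_ord n) (up u) = u.
    rewrite -map_comp -[RHS]map_id; apply: eq_map => i /=; exact: inord_val.
  pose g' (i : nat) := up (g (inord i)).
  have hg' i : all (fun e => 0 < e <= n.+1) (g' i).
    by apply/allP => e /mapP[j _ ->]; exact: ltn_ord.
  have ug w : up (extend g w) = extend (fun i : 'I_h.*2.+2 => g' i) w.
    by rewrite /extend /up map_flatten -map_comp; congr flatten; apply: eq_map => i;
      rewrite /= /g' inord_val.
  rewrite -[extend g (ladder_lhs _ _)]upK -[extend g (ladder_rhs _ _)]upK !ug.
  have [-> ->] := extend_ladder (ratio n.+1) h g'.
  by apply: congr_down; [exact: hol|exact: all_extend].
move=> sat; apply: neq.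
pose g (i : 'I_h.*2.+2) : seq 'I_n.+1 := map inord (f i).
have := sat (subst (@knuth n.+1) g); rewrite /subst /= => /pi_eqP/congr_val.
have ug w : map val (extend g w) = extend (fun i : 'I_h.*2.+2 => f i) w.
  rewrite /extend map_flatten -map_comp; congr flatten; apply: eq_map => i /=.
  rewrite -map_comp -[RHS]map_id; apply/eq_in_map => e he /=.
  by rewrite inordK // ltnS; apply: (allP (hf i)).
rewrite !ug; have [-> ->] := extend_ladder (ratio n) h f.
exact: pack_congr.
Qed.

Theorem corollary4p4 (n : nat) (n_gt0 : 0 < n) :
  exists e : semigroup_identity,
    satisfies (plactic n) e /\ ~ satisfies (plactic n.+1) e.
Proof.
have [h0|n0] := pselect (ladder_holds n 0).
  exact: exists_identity h0 (ladder_fails0 n_gt0).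
have [h [nh hS]] : exists h, ~ ladder_holds n h /\ ladder_holds n h.+1.
  apply: contrapT => H; suff : forall h, ~ ladder_holds n h.
    by move/(_ (n * n)); apply; apply: ladder_holds_top.
  by elim=> // h IH hS; apply: H; exists h.
exact: exists_identity hS (ladder_fails_next nh).
Qed.
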